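(* For each fixed integer $p\geq 2$, the following decision problem is NP-complete, even when the input is restricted to bipartite graphs: given a graph $G$, decide whether $G$ has a $P_3$-convex $p$-partition.
   Context: Graphs are finite, undirected, without loops or multiple edges. A set $S\subseteq V(G)$ is $P_3$-convex if for every path on three vertices (not necessarily induced) of $G$ whose two end-vertices belong to $S$, the middle vertex also belongs to $S$. A $P_3$-convex $p$-partition of $G$ is a partition of $V(G)$ into $p$ nonempty pairwise disjoint $P_3$-convex sets $V_1,\ldots,V_p$, each different from $V(G)$. *)

(* Defs.v *)
From mathcomp Require Import all_boot.

Set Implicit Arguments.
Unset Strict Implicit.
Unset Printing Implicit Defensive.

Notation bits := (seq bool).

(* [None] is the blank, [Some (inl b)] a bit, [Some (inr s)] a work symbol. *)
Notation cell S := (option (bool + S)).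

Inductive move := MoveL | Stay | MoveR.

(* A two-way infinite tape: [lft] lists the cells to the left of the head, the
   nearest one first, [cur] is the scanned cell, [rgt] lists the cells to its
   right; all the cells that are not listed are blank. *)
Record tape (S : Type) := Tape { lft : seq (cell S); cur : cell S; rgt : seq (cell S) }.

Definition write_move (S : Type) (t : tape S) (a : cell S * move) : tape S :=
  match a.2 with
  | MoveL => Tape (behead (lft t)) (head None (lft t)) (a.1 :: rgt t)
  | Stay => Tape (lft t) a.1 (rgt t)
  | MoveR => Tape (a.1 :: lft t) (head None (rgt t)) (behead (rgt t))
  end.

Definition tape_of_bits (S : Type) (w : bits) : tape S :=
  let s : seq (cell S) := [seq Some (inl b) | b <- w] in
  Tape [::] (head None s) (behead s).

Fixpoint leading_bits (S : Type) (s : seq (cell S)) : bits :=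
  if s is Some (inl b) :: s' then b :: leading_bits s' else [::].

(* The word that starts under the head and ends before the first non-bit. *)
Definition bits_of_tape (S : Type) (t : tape S) : bits :=
  leading_bits (cur t :: rgt t).

Record TM := MkTM {
  symb : finType;
  tidx : finType;
  input : tidx;
  output : tidx;
  state : finType;
  start : state;
  halted : pred state;
  delta : state -> {ffun tidx -> cell symb} ->
          state * {ffun tidx -> cell symb * move}
}.

Definition config (M : TM) : Type :=
  (state M * {ffun tidx M -> tape (symb M)})%type.

Definition init (M : TM) (w : bits) : config M :=
  (start M, [ffun i => tape_of_bits (symb M) (if i == input M then w else [::])]).

Definition step (M : TM) (c : config M) : config M :=
  if halted c.1 then c else
  let a := delta c.1 [ffun i => cur (c.2 i)] in
  (a.1, [ffun i => write_move (c.2 i) (a.2 i)]).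

(* Every polynomial is bounded by one of this form. *)
Definition poly_bound (c d n : nat) : nat := c * n ^ d + c.

Definition poly_time (f : bits -> bits) : Prop :=
  exists (M : TM) (c d : nat), forall w : bits,
  exists2 t : nat, t <= poly_bound c d (size w) &
    let e := iter t (@step M) (init M w) in
    halted e.1 /\ bits_of_tape (e.2 (output M)) = f w.

Definition poly_time_pred (V : pred bits) : Prop :=
  poly_time (fun w => [:: V w]).

Definition language := bits -> Prop.

(* Each bit of [x] is preceded by [true], and [false] announces [y]. *)
Definition pair_bits (x y : bits) : bits :=
  flatten [seq [:: true; b] | b <- x] ++ false :: y.

Definition NP (L : language) : Prop :=
  exists (V : pred bits) (c d : nat), poly_time_pred V /\
  forall x : bits, L x <->
    exists2 y : bits, size y <= poly_bound c d (size x) & V (pair_bits x y).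

Record problem := Problem {
  instance : Type;
  encode : instance -> bits;
  yes : instance -> Prop
}.

Definition yes_language (Pi : problem) : language :=
  fun w => exists2 i : instance Pi, w = encode i & yes i.

(* The reduction has to produce encodings of genuine instances; this matters for
   problems whose instances are restricted to a subclass. *)
Definition karp_reducible (L : language) (Pi : problem) : Prop :=
  exists2 f : bits -> bits, poly_time f &
    forall x : bits, exists2 i : instance Pi, f x = encode i & (L x <-> yes i).

Definition NP_hard (Pi : problem) : Prop :=
  forall L : language, NP L -> karp_reducible L Pi.

Definition NP_complete (Pi : problem) : Prop :=
  NP (yes_language Pi) /\ NP_hard Pi.

Definition restrict (Pi : problem) (D : instance Pi -> Prop) : problem :=
  @Problem {i : instance Pi | D i}
    (fun i => encode (sval i)) (fun i => yes (sval i)).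

Record sgraph := SGraph {
  order : nat;
  adj : rel 'I_order;
  adj_sym : symmetric adj;
  adj_irr : irreflexive adj
}.

Notation vertex G := ('I_(order G)).

(* The order in unary, then the adjacency matrix row by row. *)
Definition encode_graph (G : sgraph) : bits :=
  nseq (order G) true ++ false ::
  [seq adj u v | u <- enum (vertex G), v <- enum (vertex G)].

Definition bipartite (G : sgraph) : Prop :=
  exists c : vertex G -> bool, forall u v, adj u v -> c u != c v.

(* The vertices [u], [v], [w] of the path are distinct: [u != v] and [v != w]
   follow from the irreflexivity of [adj]. *)
Definition P3_convex (G : sgraph) (S : {set vertex G}) : Prop :=
  forall u v w : vertex G, u != w -> adj u v -> adj v w ->
    u \in S -> w \in S -> v \in S.

(* [partition] requires the blocks to be nonempty. *)
Definition has_P3_convex_partition (p : nat) (G : sgraph) : Prop :=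
  exists P : {set {set vertex G}},
    [/\ partition P [set: vertex G], #|P| = p &
        forall S, S \in P -> P3_convex S /\ S != [set: vertex G]].

Definition P3_convex_partition_problem (p : nat) : problem :=
  Problem encode_graph (has_P3_convex_partition p).

(* Main.v *)
(* A convex p-partition is a colouring with p colours, all of them used, in which no
   vertex has two neighbours of one colour different from its own; so such a
   colouring is checked in polynomial time from the list of its colours.

   Hardness: in a complete bipartite graph with more than p vertices on each
   side, all vertices get the same colour.  Take such a block for every "variable",
   and for every constraint (X; Y, Z, ...) join a new vertex of the block X to one
   new vertex of each of the blocks Y, Z, ...: the constraint excludes exactly that
   two of Y, Z, ... share a colour different from that of X.  With constant blocks
   D_0 = T, D_1 = F, D_2, ..., D_(p-1), the constraints (X; D_i, D_j) for
   all X force the constants to be distinct, as otherwise a single colour is used, and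
   (T; D_j, X) with j > 1 leaves X only the colours T and F.  Then (X; Y, Z, F) says
   X = Y and Z, (X; Y, Z, T) says X = Y or Z, (X; Y, T) says that Y implies X, and
   (T; Y, F), (F; Y, T), (T; Y, Z) assert Y, not Y, and Y or Z.  These suffice for the
   tableau of a computation.  If every tape is described relative to its head, the
   head positions disappear from the tableau, and the row t + 1 follows from the
   row t by implications with at most two premises.

   Polynomial time: the adjacency matrix of this graph and the verifier are both
   expressible by arithmetic terms with bounded sums over the input bits, and such
   terms are evaluated by multitape machines with unary counters. *)
From HB Require Import structures.
From mathcomp Require Import all_boot zify.
From Stdlib Require Import FunctionalExtensionality.
Require Import Defs.

Set Implicit Arguments.
Unset Strict Implicit.
Unset Printing Implicit Defensive.

(** * Polynomially bounded functions *)

Definition poly_bounded (f : nat -> nat) : Prop :=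
  exists c d, forall n, f n <= poly_bound c d n.

(** The added 1 covers [n = 0] and [d = 0], where the left side is 1 and the power on the right
    vanishes for positive [e]. *)
Lemma leq_exp_addn1 n d e : n ^ d <= n ^ (d + e) + 1.
Proof.
case: n => [|n].
  by apply: leq_trans (leq_addl _ _); case: d => [|d]; rewrite ?expn0 ?exp0n.
by apply: leq_trans (leq_addr _ _); rewrite leq_pexp2l // leq_addr.
Qed.

Lemma poly_bounded_le f g :
  (forall n, f n <= g n) -> poly_bounded g -> poly_bounded f.
Proof. by move=> fg [c [d gb]]; exists c, d => n; apply: leq_trans (gb n). Qed.

Lemma poly_bounded_const k : poly_bounded (fun _ => k).
Proof. by exists k, 0 => n; rewrite /poly_bound; lia. Qed.

Lemma poly_bounded_id : poly_bounded id.
Proof. by exists 1, 1 => n; rewrite /poly_bound /= expn1; lia. Qed.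

Lemma poly_bounded_add f g :
  poly_bounded f -> poly_bounded g -> poly_bounded (fun n => f n + g n).
Proof.
move=> [c [d fb]] [c' [d' gb]]; exists (2 * (c + c')), (d + d') => n.
have := fb n; have := gb n; rewrite /poly_bound => gn fn.
have := leq_exp_addn1 n d d'; have := leq_exp_addn1 n d' d.
rewrite [d' + d]addnC; nia.
Qed.

Lemma poly_bounded_mul f g :
  poly_bounded f -> poly_bounded g -> poly_bounded (fun n => f n * g n).
Proof.
move=> [c [d fb]] [c' [d' gb]]; exists (3 * (c * c')), (d + d') => n.
have h := leq_mul (fb n) (gb n); apply: leq_trans h _; rewrite /poly_bound.
have h1 := leq_exp_addn1 n d d'; have := leq_exp_addn1 n d' d.
rewrite [d' + d]addnC => h2.
have -> : (c * n ^ d + c) * (c' * n ^ d' + c') =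
  (c * c') * (n ^ (d + d') + n ^ d + n ^ d' + 1) by rewrite expnD; nia.
have -> : 3 * (c * c') * n ^ (d + d') + 3 * (c * c') =
  (c * c') * (3 * n ^ (d + d') + 3) by nia.
by rewrite leq_mul2l; apply/orP; right; lia.
Qed.

Lemma poly_bounded_exp f d :
  poly_bounded f -> poly_bounded (fun n => f n ^ d).
Proof.
move=> fb; elim: d => [|d IH]; first exact: poly_bounded_const.
apply: (@poly_bounded_le _ (fun n => f n * f n ^ d)) => [n|].
  by rewrite expnS.
exact: poly_bounded_mul.
Qed.

Lemma poly_bounded_comp f g :
  poly_bounded f -> poly_bounded g -> poly_bounded (fun n => f (g n)).
Proof.
move=> [c [d fb]] gb; apply: (poly_bounded_le (fun n => fb (g n))).
apply: poly_bounded_add; last exact: poly_bounded_const.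
apply: poly_bounded_mul; [exact: poly_bounded_const|exact: poly_bounded_exp].
Qed.

(** * Counter programs and their simulation by Turing machines *)

(** The Boolean separates the registers of term variables ([false]) from scratch registers ([true]),
    so that terms are compiled without looking for registers that their variables leave free. *)
Notation reg := (bool * nat)%type.

Record store := Store { cnt : reg -> nat; pos : nat; out : bits }.

Inductive test := Pos of reg | Bit | NonBlank.

Inductive cmd :=
| Skip | Inc of reg | Dec of reg | InL | InR | Out of bool
| Seq of cmd & cmd | If of test & cmd & cmd | While of test & cmd.

Definition upd (T : eqType) (f : T -> nat) (x : T) (v : nat) : T -> nat :=
  fun y => if y == x then v else f y.

Definition setc (s : store) (r : reg) (v : nat) : store :=
  Store (upd (cnt s) r v) (pos s) (out s).

Section Exec.

Variable w : bits.

Definition holds (b : test) (s : store) : bool :=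
  match b with
  | Pos r => 0 < cnt s r
  | Bit => nth false w (pos s)
  | NonBlank => pos s < size w
  end.

(** The cost is the exact number of machine steps: sequencing is free, a test costs one step. [Dec]
    and [InL] have no rule at zero, so a derivation also certifies that no counter head or input
    head crosses the start of its tape. *)
Inductive exec : cmd -> store -> nat -> store -> Prop :=
| ESkip s : exec Skip s 1 s
| EInc r s : exec (Inc r) s 1 (setc s r (cnt s r).+1)
| EDec r s : 0 < cnt s r -> exec (Dec r) s 1 (setc s r (cnt s r).-1)
| EInL s : 0 < pos s -> exec InL s 1 (Store (cnt s) (pos s).-1 (out s))
| EInR s : exec InR s 1 (Store (cnt s) (pos s).+1 (out s))
| EOut b s : exec (Out b) s 1 (Store (cnt s) (pos s) (b :: out s))
| ESeq c1 c2 s1 s2 s3 t1 t2 :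
    exec c1 s1 t1 s2 -> exec c2 s2 t2 s3 -> exec (Seq c1 c2) s1 (t1 + t2) s3
| EIfT b c1 c2 s s' t : holds b s -> exec c1 s t s' -> exec (If b c1 c2) s t.+1 s'
| EIfF b c1 c2 s s' t : ~~ holds b s -> exec c2 s t s' -> exec (If b c1 c2) s t.+1 s'
| EWhileT b c s1 s2 s3 t1 t2 : holds b s1 ->
    exec c s1 t1 s2 -> exec (While b c) s2 t2 s3 ->
    exec (While b c) s1 (t1 + t2).+1 s3
| EWhileF b c s : ~~ holds b s -> exec (While b c) s 1 s.

End Exec.

Fixpoint max_reg (c : cmd) : nat :=
  match c with
  | Inc r | Dec r => r.2
  | Seq c1 c2 => maxn (max_reg c1) (max_reg c2)
  | If b c1 c2 =>
      maxn (if b is Pos r then r.2 else 0) (maxn (max_reg c1) (max_reg c2))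
  | While b c => maxn (if b is Pos r then r.2 else 0) (max_reg c)
  | _ => 0
  end.

Section Compile.

Variables (w : bits) (K : nat).

Notation index := ((bool * 'I_K.+1) + bool)%type.
Notation symbol := (cell unit).
Notation obs := {ffun index -> symbol}.
Notation action := {ffun index -> symbol * move}.
Notation tapes := {ffun index -> tape unit}.

Definition mark : symbol := Some (inr tt).

Definition reg_index (r : reg) : index := inl (r.1, inord r.2).

(** The control states are the program points; [None] is the point where the condition of an [If] or
    a [While] is tested. *)
Fixpoint ctl (c : cmd) : finType :=
  match c with
  | Seq c1 c2 => (ctl c1 + ctl c2)%type
  | If _ c1 c2 => option (ctl c1 + ctl c2)
  | While _ c => option (ctl c)
  | _ => unit
  end.

Fixpoint entry (c : cmd) : ctl c :=
  match c with
  | Seq c1 c2 => inl (entry c1)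
  | If _ c1 c2 => None
  | While _ c => None
  | _ => tt
  end.

Definition keep (o : obs) : action := [ffun i => (o i, Stay)].

Definition act_on (o : obs) (j : index) (a : symbol * move) : action :=
  [ffun i => if i == j then a else (o i, Stay)].

Definition move_on (o : obs) (j : index) (m : move) : action :=
  act_on o j (o j, m).

Definition test_obs (b : test) (o : obs) : bool :=
  match b with
  | Pos r => o (reg_index r) != mark
  | Bit => o (inr true) == Some (inl true)
  | NonBlank => o (inr true) != None
  end.

(** Embeds a subprogram into a larger program: its exit is redirected to [x], and [None] for [x]
    means that the larger program exits too. *)
Definition lift_exit (A B : Type) (f : A -> B) (x : option B)
    (a : option A * action) : option B * action :=
  (if a.1 is Some s then Some (f s) else x, a.2).

Fixpoint next (c : cmd) : ctl c -> obs -> option (ctl c) * action :=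
  match c return ctl c -> obs -> option (ctl c) * action with
  | Skip => fun _ o => (None, keep o)
  | Inc r => fun _ o => (None, move_on o (reg_index r) MoveR)
  | Dec r => fun _ o => (None, move_on o (reg_index r) MoveL)
  | InL => fun _ o => (None, move_on o (inr true) MoveL)
  | InR => fun _ o => (None, move_on o (inr true) MoveR)
  | Out b => fun _ o => (None, act_on o (inr false) (Some (inl b), MoveL))
  | Seq c1 c2 => fun s o =>
      match s with
      | inl s1 => lift_exit (@inl _ _) (Some (inr (entry c2))) (next s1 o)
      | inr s2 => lift_exit (@inr _ _) None (next s2 o)
      end
  | If b c1 c2 => fun s o =>
      match s with
      | None => (Some (Some (if test_obs b o then inl (entry c1) else inr (entry c2))), keep o)
      | Some (inl s1) => lift_exit (fun s => Some (inl s)) None (next s1 o)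
      | Some (inr s2) => lift_exit (fun s => Some (inr s)) None (next s2 o)
      end
  | While b c => fun s o =>
      match s with
      | None => (if test_obs b o then Some (Some (entry c)) else None, keep o)
      | Some s1 => lift_exit (fun s => Some s) (Some None) (next s1 o)
      end
  end.

Definition look (T : tapes) : obs := [ffun i => cur (T i)].

Definition act (T : tapes) (a : action) : tapes :=
  [ffun i => write_move (T i) (a i)].

(** Leaving is itself a transition that acts on the tapes; hence control passes from one subprogram
    to the next without an idle step. *)
Inductive exits (C : Type) (nx : C -> obs -> option C * action) :
  C -> tapes -> nat -> tapes -> Prop :=
| Exit s T : (nx s (look T)).1 = None -> exits nx s T 1 (act T (nx s (look T)).2)
| Go s s' T t T' : (nx s (look T)).1 = Some s' ->
    exits nx s' (act T (nx s (look T)).2) t T' -> exits nx s T t.+1 T'.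

(** The two conclusions serve the two uses: the run of a subprogram is either prolonged by a run
    from [s0], or it ends the run of the whole program. *)
Lemma exits_lift (A B : Type) (nx : A -> obs -> option A * action)
    (nx' : B -> obs -> option B * action) (f : A -> B) (x : option B) s T t T' :
    (forall s o, nx' (f s) o = lift_exit f x (nx s o)) ->
    exits nx s T t T' ->
  if x is Some s0 then
    forall t2 T2, exits nx' s0 T' t2 T2 -> exits nx' (f s) T (t + t2) T2
  else exits nx' (f s) T t T'.
Proof.
move=> fE; elim=> {s T t T'} [s T e|s s' T t T' e _].
  have E : (nx' (f s) (look T)).1 = x by rewrite fE /lift_exit e.
  have E2 : (nx' (f s) (look T)).2 = (nx s (look T)).2 by rewrite fE.
  case: x fE E => [s0|] fE E; last by rewrite -E2; apply: Exit.
  by move=> t2 T2 h; rewrite add1n; apply: (Go E); rewrite E2.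
have E : (nx' (f s) (look T)).1 = Some (f s') by rewrite fE /lift_exit e.
have E2 : (nx' (f s) (look T)).2 = (nx s (look T)).2 by rewrite fE.
case: x fE => [s0|] fE IH; last by apply: (Go E); rewrite E2.
by move=> t2 T2 h; rewrite addSn; apply: (Go E); rewrite E2; apply: IH.
Qed.

(* The head is on cell [n] of a one-way infinite tape with contents [g]. *)
Definition on_tape (g : nat -> symbol) (n : nat) (tp : tape unit) : Prop :=
  [/\ cur tp = g n, forall j, j < n -> nth None (lft tp) j = g (n - j.+1) &
      forall j, nth None (rgt tp) j = g (n + j.+1)].

Lemma on_tape_right g n tp : on_tape g n tp ->
  on_tape g n.+1 (write_move tp (cur tp, MoveR)).
Proof.
case: tp => l c r [/= cE lE rE]; split=> /=.
- by have := rE 0; rewrite addn1; case: r {rE}.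
- by case=> [|j] h /=; rewrite ?cE ?subSS ?subn0 // lE.
- by move=> j; rewrite addSnnS -rE nth_behead.
Qed.

Lemma on_tape_left g n tp : on_tape g n.+1 tp ->
  on_tape g n (write_move tp (cur tp, MoveL)).
Proof.
case: tp => l c r [/= cE lE rE]; split=> /=.
- by have := lE 0 isT; rewrite subn1 /=; case: l {lE}.
- by move=> j h; rewrite nth_behead lE // subSS.
- by case=> [|j] /=; rewrite ?addn1 // rE addSnnS.
Qed.

Lemma write_move_stay (S : Type) (tp : tape S) :
  write_move tp (cur tp, Stay) = tp.
Proof. by case: tp. Qed.

(* A counter is stored as the distance of the head from a mark. *)
Definition counter_cell (n : nat) : symbol := if n == 0 then mark else None.

Definition input_cell (n : nat) : symbol :=
  nth None [seq Some (inl b) | b <- w] n.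

Lemma input_cell_bit n : (input_cell n == Some (inl true)) = nth false w n.
Proof.
rewrite /input_cell; have [h|h] := ltnP n (size w).
  by rewrite (nth_map false) //; case: (nth _ _ _).
by rewrite !nth_default ?size_map.
Qed.

Lemma input_cell_blank n : (input_cell n != None) = (n < size w).
Proof.
rewrite /input_cell; have [h|h] := ltnP n (size w).
  by rewrite (nth_map false).
by rewrite !nth_default ?size_map.
Qed.

(* The output is written from right to left, hence each [Out] prepends a bit. *)
Definition represents (s : store) (T : tapes) : Prop :=
  [/\ forall r, r.2 <= K -> on_tape counter_cell (cnt s r) (T (reg_index r)),
      on_tape input_cell (pos s) (T (inr true)) &
      T (inr false) = Tape [::] None [seq Some (inl b) | b <- out s]].

Lemma test_obsE b s T : represents s T ->
  (if b is Pos r then r.2 else 0) <= K -> test_obs b (look T) = holds w b s.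
Proof.
case=> rc [ic _ _] _; case: b => [r|_|_] /=.
- move=> /rc[e _ _]; rewrite ffunE e /counter_cell.
  by case: (cnt s r).
- by rewrite ffunE ic input_cell_bit.
- by rewrite ffunE ic input_cell_blank.
Qed.

Lemma act_keep T : act T (keep (look T)) = T.
Proof. by apply/ffunP => i; rewrite !ffunE write_move_stay. Qed.

Lemma act_moveE T j m i : act T (move_on (look T) j m) i =
  if i == j then write_move (T j) (cur (T j), m) else T i.
Proof.
by rewrite !ffunE; case: eqP => [->|_] //; rewrite write_move_stay.
Qed.

Lemma act_onE T j a i : act T (act_on (look T) j a) i =
  if i == j then write_move (T j) a else T i.
Proof.
by rewrite !ffunE; case: eqP => [->|_] //; rewrite write_move_stay.
Qed.

Lemma reg_index_inj r r' : r.2 <= K -> r'.2 <= K ->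
  (reg_index r == reg_index r') = (r == r').
Proof.
case: r r' => [b x] [b' x'] /= h h'; apply/eqP/eqP => [[-> /(congr1 val)]|[-> ->] //].
by rewrite /= !inordK // => ->.
Qed.

(** Induction on the execution: an elementary command is one transition that changes at most one
    tape, and composite commands are handled by [exits_lift]. The bound [K] keeps the registers on
    distinct tapes. *)
Lemma exec_exits c s t s' T : exec w c s t s' -> max_reg c <= K ->
  represents s T -> exists2 T', represents s' T' & exits (@next c) (entry c) T t T'.
Proof.
move=> ex; elim: ex T => {c s t s'}.
- move=> s T _ rT; exists T => //.
  by rewrite -{2}[T]act_keep; exact: (@Exit _ (@next Skip)).
- move=> r s T /= hr [rc ri ro].
  exists (act T (move_on (look T) (reg_index r) MoveR)); last exact: (@Exit _ (@next (Inc r))).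
  split; [|by rewrite act_moveE|by rewrite act_moveE].
  move=> r' hr'; rewrite act_moveE reg_index_inj // /= /upd.
  by case: eqP => [e|_]; [rewrite -e; apply: on_tape_right|]; apply: rc.
- move=> r s h T /= hr [rc ri ro].
  exists (act T (move_on (look T) (reg_index r) MoveL)); last exact: (@Exit _ (@next (Dec r))).
  split; [|by rewrite act_moveE|by rewrite act_moveE].
  move=> r' hr'; rewrite act_moveE reg_index_inj // /= /upd.
  case: eqP => [e|_]; last exact: rc.
  by rewrite -e in h *; apply: on_tape_left; rewrite prednK //; apply: rc.
- move=> s h T /= hr [rc ri ro].
  exists (act T (move_on (look T) (inr true) MoveL)); last exact: (@Exit _ (@next InL)).
  split; [by move=> r' hr'; rewrite act_moveE /=; apply: rc| |by rewrite act_moveE].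
  by rewrite act_moveE eqxx; apply: on_tape_left; rewrite /= prednK.
- move=> s T /= hr [rc ri ro].
  exists (act T (move_on (look T) (inr true) MoveR)); last exact: (@Exit _ (@next InR)).
  split; [by move=> r' hr'; rewrite act_moveE /=; apply: rc| |by rewrite act_moveE].
  by rewrite act_moveE eqxx; apply: on_tape_right.
- move=> b s T /= hr [rc ri ro].
  exists (act T (act_on (look T) (inr false) (Some (inl b), MoveL)));
    last exact: (@Exit _ (@next (Out b))).
  split; [by move=> r' hr'; rewrite act_onE /=; apply: rc|by rewrite act_onE|].
  by rewrite act_onE eqxx ro.
- move=> c1 c2 s1 s2 s3 t1 t2 _ IH1 _ IH2 T /=; rewrite geq_max => /andP[h1 h2] r1.
  have [T2 r2 e1] := IH1 _ h1 r1; have [T3 r3 e2] := IH2 _ h2 r2.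
  exists T3 => //.
  apply: (@exits_lift _ _ _ (@next (Seq c1 c2)) inl (Some (inr (entry c2)))
    _ _ _ _ _ e1) => //.
  exact: (@exits_lift _ _ _ (@next (Seq c1 c2)) inr None _ _ _ _ _ e2).
- move=> b c1 c2 s s' t hb _ IH T /=; rewrite !geq_max => /and3P[h0 h1 h2] r1.
  have [T2 r2 e1] := IH _ h1 r1; exists T2 => //.
  apply: (@Go _ (@next (If b c1 c2)) _ (Some (inl (entry c1)))) => /=.
    by rewrite (test_obsE r1) // hb.
  rewrite act_keep.
  exact: (@exits_lift _ _ _ (@next (If b c1 c2)) (fun s => Some (inl s)) None
    _ _ _ _ _ e1).
- move=> b c1 c2 s s' t hb _ IH T /=; rewrite !geq_max => /and3P[h0 h1 h2] r1.
  have [T2 r2 e1] := IH _ h2 r1; exists T2 => //.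
  apply: (@Go _ (@next (If b c1 c2)) _ (Some (inr (entry c2)))) => /=.
    by rewrite (test_obsE r1) // (negbTE hb).
  rewrite act_keep.
  exact: (@exits_lift _ _ _ (@next (If b c1 c2)) (fun s => Some (inr s)) None
    _ _ _ _ _ e1).
- move=> b c s1 s2 s3 t1 t2 hb _ IH1 _ IH2 T h r1.
  move: (h); rewrite /= !geq_max => /andP[h0 h1].
  have [T2 r2 e1] := IH1 _ h1 r1; have [T3 r3 e2] := IH2 _ h r2.
  exists T3 => //.
  apply: (@Go _ (@next (While b c)) _ (Some (entry c))) => /=.
    by rewrite (test_obsE r1) // hb.
  rewrite act_keep.
  exact: (@exits_lift _ _ _ (@next (While b c)) (fun s => Some s) (Some None) _ _ _ _ _ e1).
- move=> b c s hb T /=; rewrite !geq_max => /andP[h0 h1] r1; exists T => //.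
  rewrite -{2}[T]act_keep.
  by apply: (@Exit _ (@next (While b c))) => /=; rewrite (test_obsE r1) // (negbTE hb).
Qed.

End Compile.

Section Machine.

Variables (c : cmd) (K : nat).
Hypothesis cK : max_reg c <= K.

Notation index := ((bool * 'I_K.+1) + bool)%type.

(* [inl None] starts the machine, [inl (Some false)] performs the last step and
   [inl (Some true)] is the halting state. *)
Definition mstate : finType := (option bool + ctl c)%type.

(** The first step marks the zero cell of every counter. After the run the output head stands on the
    blank to the left of the output, so the last step moves it right, onto the first bit. *)
Definition mdelta (q : mstate) (o : {ffun index -> cell unit}) :
    mstate * {ffun index -> cell unit * move} :=
  match q with
  | inl None =>
      (inr (entry c), [ffun i => (if i is inl _ then mark else o i, Stay)])
  | inl (Some _) => (inl (Some true), move_on o (inr false) MoveR)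
  | inr s => let a := next s o in
      (if a.1 is Some s' then inr s' else inl (Some false), a.2)
  end.

Definition machine : TM :=
  @MkTM unit index (inr true) (inr false) mstate (inl None)
    (fun q => q == inl (Some true)) mdelta.

Lemma machine_exits s T t T' : exits (@next K c) s T t T' ->
  iter t (@step machine) (inr s, T) = (inl (Some false), T').
Proof.
elim=> {s T t T'} [s T e|s s' T t T' e _ IH]; first by rewrite /= /step /= e.
by rewrite iterSr {2}/step /= e IH.
Qed.

Definition store0 : store := Store (fun _ => 0) 0 [::].

Lemma machine_run w t s : exec w c store0 t s ->
  let e := iter t.+2 (@step machine) (init machine w) in
  halted e.1 /\ bits_of_tape (e.2 (output machine)) = out s.
Proof.
move=> ex.
pose T0 : {ffun index -> tape unit} := [ffun i =>
  if i is inl _ then Tape [::] mark [::]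
  else tape_of_bits unit (if i == inr true then w else [::])].
have e0 : step (init machine w) = (inr (entry c), T0).
  rewrite /step /=; congr pair; apply/ffunP => i; rewrite !ffunE.
  by case: i => [r|[]] /=.
have r0 : represents w store0 T0.
  split=> /=; last by rewrite ffunE.
  - move=> r _; rewrite ffunE /=; split=> //= j.
    by rewrite nth_nil add0n.
  - rewrite ffunE eqxx /=; split=> /=; rewrite /input_cell //.
    by move=> j; rewrite nth_behead.
have [T' [_ _ ro] /machine_exits e1] := exec_exits ex cK r0.
(* The two additional steps are the marking of the counters and the final move on the output
   tape. *)
rewrite iterS iterSr e0 e1 /step /=; split=> //.
rewrite act_onE eqxx /= !ffunE ro.
rewrite /bits_of_tape /=; case: (out s) => [|b l] //=; congr cons.
by elim: l => [|a l IH] //=; congr cons.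
Qed.

End Machine.

Lemma poly_time_exec (f : bits -> bits) (c : cmd) (tm : nat -> nat) :
    poly_bounded tm ->
    (forall w, exists2 s, out s = f w &
       exists2 t, t <= tm (size w) & exec w c store0 t s) ->
  poly_time f.
Proof.
move=> /poly_bounded_add/(_ (poly_bounded_const 2))[a [d tb]] h.
exists (@machine c (max_reg c)), a, d => w.
have [s <- [t tle ex]] := h w.
exists t.+2; last exact: (machine_run (leqnn _) ex).
by apply: leq_trans (tb _); lia.
Qed.

(** * Arithmetic terms with bounded sums *)

(** Bounded sums keep all values polynomial in the input length, and products, quotients and bounded
    quantifiers are definable from them. A positive value counts as true. *)
Inductive expr :=
| Var of nat | Cst of nat | Size | Add of expr & expr | Sub of expr & expr
| Bitat of expr | Sum of nat & expr & expr.

Inductive gen := Emit of expr | Cat of gen & gen | For of nat & expr & gen.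

Section Semantics.

Variable w : bits.

Fixpoint eval (env : nat -> nat) (e : expr) : nat :=
  match e with
  | Var x => env x
  | Cst n => n
  | Size => size w
  | Add a b => eval env a + eval env b
  | Sub a b => eval env a - eval env b
  | Bitat a => nth false w (eval env a)
  | Sum x a b => \sum_(i < eval env a) eval (upd env x i) b
  end.

Fixpoint gen_eval (env : nat -> nat) (g : gen) : bits :=
  match g with
  | Emit e => [:: 0 < eval env e]
  | Cat g h => gen_eval env g ++ gen_eval env h
  | For x a g =>
      flatten [seq gen_eval (upd env x i) g | i <- iota 0 (eval env a)]
  end.

End Semantics.

(** * Compilation of terms into counter programs *)

Notation vreg x := (false, x).
Notation sreg d := (true, d).

Definition transfer (r1 r2 : reg) : cmd := While (Pos r1) (Seq (Dec r1) (Inc r2)).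

(* Runs [c] for the values [n - 1, ..., 0] of the variable [x], where [n] is the
   contents of the scratch register [d]; the old value of [x] is kept in the
   scratch register [d.+1]. *)
Definition loop (x d : nat) (c : cmd) : cmd :=
  Seq (transfer (vreg x) (sreg d.+1)) (Seq (transfer (sreg d) (vreg x))
  (Seq (While (Pos (vreg x)) (Seq (Dec (vreg x)) c))
       (transfer (sreg d.+1) (vreg x)))).

(* The value of [e] goes to the scratch register [d]; the scratch registers from
   [d] on are initially zero, and those after [d] are zero again at the end. *)
Fixpoint compile (e : expr) (d : nat) : cmd :=
  match e with
  | Var x =>
      Seq (While (Pos (vreg x)) (Seq (Dec (vreg x)) (Seq (Inc (sreg d)) (Inc (sreg d.+1)))))
          (transfer (sreg d.+1) (vreg x))
  | Cst n => iter n (Seq (Inc (sreg d))) Skip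
  | Size =>
      Seq (While NonBlank (Seq InR (Seq (Inc (sreg d)) (Inc (sreg d.+1)))))
          (While (Pos (sreg d.+1)) (Seq (Dec (sreg d.+1)) InL))
  | Add a b =>
      Seq (compile a d) (Seq (compile b d.+1) (transfer (sreg d.+1) (sreg d)))
  | Sub a b =>
      Seq (compile a d) (Seq (compile b d.+1)
        (While (Pos (sreg d.+1))
           (Seq (Dec (sreg d.+1)) (If (Pos (sreg d)) (Dec (sreg d)) Skip))))
  | Bitat a =>
      Seq (compile a d)
      (Seq (While (Pos (sreg d)) (Seq (Dec (sreg d)) (Seq (Inc (sreg d.+1)) InR)))
      (Seq (If Bit (Inc (sreg d)) Skip)
           (While (Pos (sreg d.+1)) (Seq (Dec (sreg d.+1)) InL))))
  | Sum x a b =>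
      Seq (compile a d.+1)
          (loop x d.+1 (Seq (compile b d.+3) (transfer (sreg d.+3) (sreg d))))
  end.

Fixpoint gen_compile (g : gen) (d : nat) : cmd :=
  match g with
  | Emit e =>
      Seq (compile e d) (Seq (If (Pos (sreg d)) (Out true) (Out false))
                             (While (Pos (sreg d)) (Dec (sreg d))))
  | Cat g h => Seq (gen_compile h d) (gen_compile g d)
  | For x a g => Seq (compile a d) (loop x d (gen_compile g d.+2))
  end.

(** [B] bounds the input length and all variables; a summation variable may exceed it, so the body
    of a sum is measured against [B + value_bound a B]. *)
Fixpoint value_bound (e : expr) (B : nat) : nat :=
  match e with
  | Var _ | Size => B
  | Cst n => n
  | Add a b => value_bound a B + value_bound b B
  | Sub a _ => value_bound a B
  | Bitat _ => 1
  | Sum _ a b => value_bound a B * value_bound b (B + value_bound a B)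
  end.

(** The summands are the four parts of [loop]: saving [x], loading the counter, the iterations with
    one test and one [Dec] each, and restoring [x]. *)
Definition loop_bound (B n t : nat) : nat :=
  (3 * B + 1) + ((3 * n + 1) + ((n * (t + 2) + 1) + (3 * B + 1))).

Fixpoint time_bound (e : expr) (B : nat) : nat :=
  match e with
  | Var _ => (4 * B + 1) + (3 * B + 1)
  | Cst n => n + 1
  | Size => (4 * B + 1) + (3 * B + 1)
  | Add a b =>
      time_bound a B + (time_bound b B + (3 * value_bound b B + 1))
  | Sub a b =>
      time_bound a B + (time_bound b B + (4 * value_bound b B + 1))
  | Bitat a =>
      time_bound a B + ((4 * value_bound a B + 1) + (2 + (3 * value_bound a B + 1)))
  | Sum _ a b =>
      let B' := B + value_bound a B in
      time_bound a B + loop_bound B (value_bound a B)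
        (time_bound b B' + (3 * value_bound b B' + 1))
  end.

Fixpoint gen_time_bound (g : gen) (B : nat) : nat :=
  match g with
  | Emit e => time_bound e B + (2 + (2 * value_bound e B + 1))
  | Cat g h => gen_time_bound h B + gen_time_bound g B
  | For _ a g =>
      time_bound a B + loop_bound B (value_bound a B)
        (gen_time_bound g (B + value_bound a B))
  end.

Lemma poly_bounded_value e : poly_bounded (value_bound e).
Proof.
elim: e => [x|n||a IHa b IHb|a IHa b IHb|a IHa|x a IHa b IHb] /=;
  try solve [exact: poly_bounded_id | exact: poly_bounded_const
            | exact: poly_bounded_add | by []].
apply: poly_bounded_mul => //; apply: (poly_bounded_comp IHb).
exact: (poly_bounded_add poly_bounded_id).
Qed.

Ltac poly_auto :=
  repeat first [ exact: poly_bounded_const | exact: poly_bounded_id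
    | exact: poly_bounded_value | assumption
    | apply: poly_bounded_add | apply: poly_bounded_mul
    | match goal with
      | |- poly_bounded (fun n => time_bound ?e _) =>
          apply: (@poly_bounded_comp (time_bound e))
      | |- poly_bounded (fun n => value_bound ?e _) =>
          apply: (@poly_bounded_comp (value_bound e))
      | |- poly_bounded (fun n => gen_time_bound ?e _) =>
          apply: (@poly_bounded_comp (gen_time_bound e))
      end ].

Lemma poly_bounded_time e : poly_bounded (time_bound e).
Proof.
elim: e => [x|n||a IHa b IHb|a IHa b IHb|a IHa|x a IHa b IHb] /=;
  rewrite /loop_bound; poly_auto.
Qed.

Lemma poly_bounded_gen_time g : poly_bounded (gen_time_bound g).
Proof.
elim: g => [e|g IHg h IHh|x a g IHg] /=; rewrite /loop_bound; poly_auto.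
all: exact: poly_bounded_time.
Qed.

Section Bounded.

Variable w : bits.

Lemma eval_bound env e B : (forall x, env x <= B) -> size w <= B ->
  eval w env e <= value_bound e B.
Proof.
move=> + wB; have : size w <= B by [].
elim: e env B {wB} => [x|n||a IHa b IHb|a IHa b IHb|a IHa|x a IHa b IHb] env B wB eB //=.
- by apply: leq_add; [apply: IHa|apply: IHb].
- by apply: leq_trans (leq_subr _ _) _; apply: IHa.
- by case: nth.
- have ha := IHa _ _ wB eB.
  apply: (@leq_trans (\sum_(i < eval w env a) value_bound b (B + value_bound a B))).
    apply: leq_sum => i _; apply: IHb; first by lia.
    by move=> y; rewrite /upd; case: eqP => _; have := eB y; have := ltn_ord i; lia.
  by rewrite sum_nat_const card_ord leq_mul2r ha orbT.
Qed.

Definition run (c : cmd) (s : store) (T : nat) (s' : store) : Prop :=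
  exists2 t, t <= T & exec w c s t s'.

Lemma run_seq c1 c2 s1 s2 s3 T1 T2 :
  run c1 s1 T1 s2 -> run c2 s2 T2 s3 -> run (Seq c1 c2) s1 (T1 + T2) s3.
Proof.
by move=> [t1 h1 e1] [t2 h2 e2]; exists (t1 + t2); [lia|apply: ESeq e1 e2].
Qed.

(** [F i] is the store at the test after [i] iterations; giving the whole sequence replaces a loop
    invariant. *)
Lemma run_while b c (F : nat -> store) n T :
  (forall i, i < n -> holds w b (F i) /\ run c (F i) T (F i.+1)) ->
  ~~ holds w b (F n) -> run (While b c) (F 0) (n * T.+1 + 1) (F n).
Proof.
elim: n F => [|n IH] F h hn; first by exists 1; [lia|apply: EWhileF].
have [t tT ex] := IH (F \o S) (fun i hi => h i.+1 hi) hn.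
have [hb [t0 h0 e0]] := h 0 isT.
by exists (t0 + t).+1; [lia|apply: (EWhileT hb e0 ex)].
Qed.

Lemma run_le c s T T' s' : run c s T s' -> T <= T' -> run c s T' s'.
Proof. by move=> [t h e] h'; exists t => //; lia. Qed.

Lemma store_ext s s' : (forall r, cnt s r = cnt s' r) -> pos s = pos s' ->
  out s = out s' -> s = s'.
Proof.
case: s s' => c p o [c' p' o'] /= h -> ->; congr Store.
exact: functional_extensionality.
Qed.

Lemma exec_eq c s t s1 s2 : exec w c s t s1 -> s1 = s2 -> exec w c s t s2.
Proof. by move=> h <-. Qed.

End Bounded.

Ltac split_eqs :=
  repeat match goal with
  | |- context [?a == ?b] => case: (@eqP _ a b) => ?
  end.

Ltac regs_neq :=
  match goal with H : (_, _) = (_, _) |- _ => case: H; lia end.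

Ltac subst_regs :=
  repeat match goal with 
  | H : ?r = (_, _) |- _ => is_var r; subst r
  | H : ?r = ?r' |- _ => is_var r; is_var r'; subst r
  end.

Ltac store_eq :=
  apply: store_ext => //=; try (move=> ?; rewrite /upd /=; split_eqs; subst_regs) => //;
  try solve [regs_neq | congruence | lia].

Ltac lookup :=
  rewrite /= /upd /=; split_eqs; subst_regs => //;
  try solve [regs_neq | congruence | lia].

Section CompileExpr.

Variable w : bits.

Notation run := (run w).

Lemma run_transfer s r1 r2 : r1 != r2 ->
  run (transfer r1 r2) s (3 * cnt s r1 + 1)
      (setc (setc s r2 (cnt s r2 + cnt s r1)) r1 0).
Proof.
move=> r12.
pose F i := setc (setc s r2 (cnt s r2 + i)) r1 (cnt s r1 - i).
have -> : setc (setc s r2 (cnt s r2 + cnt s r1)) r1 0 = F (cnt s r1) by rewrite /F subnn.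
(* Each unit takes three steps: the test, [Dec] and [Inc]. *)
rewrite mulnC -{1}(_ : F 0 = s); last by rewrite /F; store_eq.
apply: run_while => [i hi|]; last by lookup.
split; first by lookup.
exists 2 => //; apply: (@ESeq _ _ _ _ _ _ 1 1); first by apply: EDec; lookup.
apply: exec_eq; first exact: EInc.
by rewrite /F; store_eq; move: r12; rewrite eqxx.
Qed.

(** [F k] records the effect of [k] rounds on everything but three control registers, which [G]
    overrides: the emptied counter [d], the saved value [v], and [x] itself. [Dec] precedes the
    body, so round [k] sees [x = n - k.+1]. *)
Lemma run_loop x d c s n (F : nat -> store) T :
    let v := cnt s (vreg x) in
    let G k i := setc (setc (setc (F k) (sreg d) 0) (sreg d.+1) v) (vreg x) i in
    F 0 = s -> cnt s (sreg d) = n -> cnt s (sreg d.+1) = 0 ->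
    (forall k, k < n -> run c (G k (n - k.+1)) T (G k.+1 (n - k.+1))) ->
  run (loop x d c) s (loop_bound v n T)
      (setc (setc (setc (F n) (sreg d) 0) (sreg d.+1) 0) (vreg x) v).
Proof.
move=> v G F0 sn s0 body.
apply: run_seq; first exact: run_transfer.
apply: run_seq.
  apply: run_le; first exact: run_transfer.
  by lookup.
apply: run_seq.
  set s2 := setc _ _ _; have <- : G 0 n = s2 by rewrite /G /s2 F0; store_eq.
  rewrite -{1}[n]subn0 addn2.
  apply: (@run_while _ _ _ (fun k => G k (n - k)) n T.+1); last by lookup.
  move=> i hi; split; first by lookup.
  rewrite -add1n; apply: run_seq (body i hi); exists 1 => //.
  apply: exec_eq; first by apply: EDec; lookup.
  by rewrite /G; store_eq.
rewrite subnn; set s3 := setc (setc (setc (F n) _ _) _ 0) _ _.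
have -> : s3 = setc (setc (G n 0) (vreg x)
    (cnt (G n 0) (vreg x) + cnt (G n 0) (sreg d.+1))) (sreg d.+1) 0.
  by rewrite /G /s3; store_eq.
by apply: run_le; [exact: run_transfer|lookup].
Qed.

Definition env (s : store) : nat -> nat := fun x => cnt s (vreg x).

Definition clean (d : nat) (s : store) : Prop :=
  forall j, d <= j -> cnt s (sreg j) = 0.

Lemma clean_le d d' s : d <= d' -> clean d s -> clean d' s.
Proof. by move=> h cs j hj; apply: cs; lia. Qed.

Lemma clean_set d s v : clean d s -> clean d.+1 (setc s (sreg d) v).
Proof.
move=> cs j hj; rewrite /= /upd; case: eqP => [[]|_]; first by lia.
by apply: cs; lia.
Qed.

Lemma env_set_scratch s d v : env (setc s (sreg d) v) = env s.
Proof. by []. Qed.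

Lemma env_set_var s x v : env (setc s (vreg x) v) = upd (env s) x v.
Proof.
by apply: functional_extensionality => y; rewrite /env /= /upd xpair_eqE.
Qed.

Lemma run_left s d p : cnt s (sreg d) = p -> p <= pos s ->
  run (While (Pos (sreg d)) (Seq (Dec (sreg d)) InL)) s (3 * p + 1)
      (Store (upd (cnt s) (sreg d) 0) (pos s - p) (out s)).
Proof.
move=> sp ple.
pose F i := Store (upd (cnt s) (sreg d) (p - i)) (pos s - i) (out s).
have -> : Store (upd (cnt s) (sreg d) 0) (pos s - p) (out s) = F p by rewrite /F subnn.
rewrite mulnC -{1}(_ : F 0 = s); last by rewrite /F; store_eq.
apply: run_while => [i hi|]; last by lookup.
split; first by lookup.
exists 2 => //; apply: (@ESeq _ _ _ _ _ _ 1 1).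
  by apply: EDec; lookup.
apply: exec_eq; first by apply: EInL => /=; lia.
by rewrite /F; store_eq.
Qed.

(** Induction on the term. Intermediate results occupy the scratch registers in the manner of a
    stack, so the second operand of a binary operation is computed in [d.+1] while the first one
    waits in [d]. *)
Lemma run_compile e d s B : clean d s -> pos s = 0 ->
    (forall x, env s x <= B) -> size w <= B ->
  run (compile e d) s (time_bound e B) (setc s (sreg d) (eval w (env s) e)).
Proof.
elim: e d s B => [x|n||a IHa b IHb|a IHa b IHb|a IHa|x a IHa b IHb] d s B cs p0 eB wB /=.
- have cd := cs d (leqnn _); have cd1 := cs d.+1 (leqnSn _).
  pose F i := setc (setc (setc s (sreg d) i) (sreg d.+1) i) (vreg x) (env s x - i).
  apply: (@run_seq _ _ _ _ (F (env s x))).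
    have F0 : F 0 = s by rewrite /F; store_eq; rewrite /env; lia.
    rewrite -{1}F0; apply: (@run_le _ _ _ (env s x * 3.+1 + 1)).
      apply: run_while => [i hi|]; last by lookup.
      split; first by lookup.
      exists 3 => //; apply: (@ESeq _ _ _ _ _ _ 1 2).
        by apply: EDec; lookup.
      apply: (@ESeq _ _ _ _ _ _ 1 1); first exact: EInc.
      apply: exec_eq; first exact: EInc.
      by rewrite /F; store_eq.
    by have := eB x; lia.
  set s1 := F _.
  have -> : setc s (sreg d) (env s x) =
      setc (setc s1 (vreg x) (cnt s1 (vreg x) + cnt s1 (sreg d.+1))) (sreg d.+1) 0.
    by rewrite /s1 /F; store_eq; rewrite /env; lia.
  apply: run_le; first exact: run_transfer.
  by have := eB x; rewrite /s1; lookup.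
- have {cs} cd := cs d (leqnn _).
  have h : forall m, run (iter n (Seq (Inc (sreg d))) Skip)
       (setc s (sreg d) m) (n + 1) (setc s (sreg d) (m + n)).
    elim: n => [|n IH] m /=; first by exists 1 => //; rewrite addn0; apply: ESkip.
    rewrite addSn -add1n; apply: run_seq.
      by exists 1 => //; apply: exec_eq; [exact: EInc|reflexivity].
    have := IH m.+1; rewrite addSnnS; congr run; store_eq.
  by have := h 0; congr run; store_eq.
- have cd := cs d (leqnn _); have cd1 := cs d.+1 (leqnSn _).
  pose F i := Store (upd (upd (cnt s) (sreg d) i) (sreg d.+1) i) i (out s).
  apply: (@run_seq _ _ _ _ (F (size w))).
    have F0 : F 0 = s by rewrite /F; store_eq.
    rewrite -{1}F0; apply: (@run_le _ _ _ (size w * 3.+1 + 1)); last by lia.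
    apply: run_while => [i hi|]; last by rewrite /= ltnn.
    split=> //.
    exists 3 => //; apply: (@ESeq _ _ _ _ _ _ 1 2); first exact: EInR.
    apply: (@ESeq _ _ _ _ _ _ 1 1); first exact: EInc.
    apply: exec_eq; first exact: EInc.
    by rewrite /F; store_eq.
  apply: (@run_le _ _ _ (3 * size w + 1)); last by lia.
  set s1 := F _.
  have -> : setc s (sreg d) (size w) =
    Store (upd (cnt s1) (sreg d.+1) 0) (pos s1 - size w) (out s1).
    by rewrite /s1 /F; store_eq; rewrite ?p0; lia.
  by apply: run_left; rewrite //= /upd eqxx.
- apply: run_seq; first exact: IHa.
  apply: run_seq; first by apply: IHb => //; apply: clean_set.
  have cd1 := cs d.+1 (leqnSn _).
  have h := eval_bound b eB wB.
  set s1 := setc (setc s _ _) _ _; set s2 := setc s _ _.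
  have -> : s2 = setc (setc s1 (sreg d) (cnt s1 (sreg d) + cnt s1 (sreg d.+1))) (sreg d.+1) 0.
    by rewrite /s1 /s2; store_eq.
  apply: run_le; first by apply: run_transfer; rewrite xpair_eqE /=; lia.
  by rewrite /s1 /= /upd eqxx env_set_scratch; lia.
- apply: run_seq; first exact: IHa.
  apply: run_seq; first by apply: IHb => //; apply: clean_set.
  have cd1 := cs d.+1 (leqnSn _).
  have h := eval_bound b eB wB.
  rewrite env_set_scratch; set va := eval w _ a; set vb := eval w _ b.
  pose F i := setc (setc s (sreg d) (va - i)) (sreg d.+1) (vb - i).
  have -> : setc (setc s (sreg d) va) (sreg d.+1) vb = F 0 by rewrite /F !subn0.
  have -> : setc s (sreg d) (va - vb) = F vb by rewrite /F; store_eq.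
  apply: (@run_le _ _ _ (vb * 3.+1 + 1)); last by lia.
  apply: run_while => [i hi|]; last by lookup.
  split; first by lookup.
  exists 3 => //; apply: (@ESeq _ _ _ _ _ _ 1 2).
    by apply: EDec; lookup.
  case: (ltnP i va) => hia.
    apply: EIfT; first by rewrite /= /upd /= xpair_eqE ltn_eqF //= eqxx subn_gt0.
    apply: exec_eq.
      by apply: EDec; rewrite /= /upd /= xpair_eqE ltn_eqF //= eqxx subn_gt0.
    by rewrite /F; store_eq.
  apply: EIfF; first by rewrite /= /upd /= xpair_eqE ltn_eqF //= eqxx subn_gt0 -leqNgt.
  apply: exec_eq; first exact: ESkip.
  by rewrite /F; store_eq.
- have cd1 := cs d.+1 (leqnSn _); have cd := cs d (leqnn _).
  have h := eval_bound a eB wB.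
  apply: run_seq; first exact: IHa.
  set va := eval w _ a.
  pose F i := Store (upd (upd (cnt s) (sreg d) (va - i)) (sreg d.+1) i) i (out s).
  apply: (@run_seq _ _ _ _ (F va)).
    have -> : setc s (sreg d) va = F 0 by rewrite /F subn0; store_eq.
    apply: (@run_le _ _ _ (va * 3.+1 + 1)); last by lia.
    apply: run_while => [i hi|]; last by rewrite /= /upd /= xpair_eqE ltn_eqF //= eqxx subnn.
    have hi' : 0 < cnt (F i) (sreg d).
      by rewrite /= /upd /= xpair_eqE ltn_eqF //= eqxx subn_gt0.
    split => //.
    exists 3 => //; apply: (@ESeq _ _ _ _ _ _ 1 2); first exact: EDec.
    apply: (@ESeq _ _ _ _ _ _ 1 1); first exact: EInc.
    apply: exec_eq; first exact: EInR.
    by rewrite /F; store_eq.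
  set s1 := F va.
  pose s2 := setc s1 (sreg d) (nth false w va).
  apply: (@run_seq _ _ _ _ s2).
    exists 2 => //; rewrite /s2; case e : (nth false w va).
      apply: EIfT => //; apply: exec_eq; first exact: EInc.
      by rewrite /s1 /F; store_eq.
    apply: EIfF; first by rewrite /= e.
    apply: exec_eq; first exact: ESkip.
    by rewrite /s1 /F; store_eq.
  apply: (@run_le _ _ _ (3 * va + 1)); last by lia.
  have -> : setc s (sreg d) (nth false w va) =
    Store (upd (cnt s2) (sreg d.+1) 0) (pos s2 - va) (out s2).
    by rewrite /s2 /s1 /F; store_eq; rewrite ?p0 ?subnn.
  by apply: run_left; rewrite /s2 /s1 /F; lookup.
- have ha := eval_bound a eB wB.
  apply: run_seq; first by apply: IHa => //; apply: clean_le cs.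
  set n := eval w (env s) a.
  pose val i := eval w (upd (env s) x i) b.
  (* The loop counts down, so after [k] rounds the last [k] summands have been added. *)
  pose F k := setc (setc s (sreg d.+1) n) (sreg d) (\sum_(j < k) val (n - j.+1)).
  have cd0 := cs d (leqnn _); have cd1 := cs d.+1 (leqnSn _).
  have cd2 := cs d.+2 ltac:(lia); have cd3 := cs d.+3 ltac:(lia).
  set s1 := setc s (sreg d.+1) n.
  have F0 : F 0 = s1 by rewrite /F big_ord0 /s1; store_eq.
  set T := time_bound b _ + _.
  have body k : k < n -> run (Seq (compile b d.+3) (transfer (sreg d.+3) (sreg d)))
      (setc (setc (setc (F k) (sreg d.+1) 0) (sreg d.+2) (cnt s1 (vreg x)))
        (vreg x) (n - k.+1))
      T
      (setc (setc (setc (F k.+1) (sreg d.+1) 0) (sreg d.+2) (cnt s1 (vreg x)))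
        (vreg x) (n - k.+1)).
    move=> kn; set s2 := setc _ _ _.
    have es2 : env s2 = upd (env s) x (n - k.+1) by rewrite /s2 env_set_var.
    have eB2 : forall y, env s2 y <= B + value_bound a B.
      move=> y; rewrite es2 /upd; case: eqP => _; first by lia.
      by have := eB y; lia.
    have wB2 : size w <= B + value_bound a B by lia.
    have hb := eval_bound b eB2 wB2.
    apply: run_seq.
      apply: IHb eB2 wB2; last by [].
      move=> j hj; rewrite /s2 /= /upd /= !xpair_eqE /=.
      by do 3! (rewrite gtn_eqF /=; last by lia); apply: cs; lia.
    set s3 := setc s2 _ _; set s4 := setc _ _ _.
    have -> : s4 = setc (setc s3 (sreg d) (cnt s3 (sreg d) + cnt s3 (sreg d.+3)))
        (sreg d.+3) 0.
      rewrite /s4 /s3 /s2 /F; store_eq.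
      by rewrite big_ord_recr /= /val -es2.
    apply: run_le; first by apply: run_transfer; rewrite xpair_eqE /=; lia.
    by rewrite /s3 /= /upd eqxx; lia.
  have := run_loop F0 _ _ body.
  have e1 : cnt s1 (sreg d.+1) = n by rewrite /s1 /= /upd eqxx.
  have e2 : cnt s1 (sreg d.+2) = 0 by rewrite /s1; rewrite /= /upd xpair_eqE gtn_eqF.
  move=> /(_ e1 e2).
  set s5 := setc _ _ _; set s6 := setc _ _ _ => h.
  have -> : s6 = s5.
    rewrite /s6 /s5 /F; store_eq.
    by rewrite (reindex_inj rev_ord_inj) /=; apply: eq_bigr.
  apply: run_le h _; rewrite /loop_bound.
  have := eB x; have hm := leq_mul ha (leqnn (T + 2)).
  by rewrite /s1 /env /= /upd /=; rewrite -/n in ha hm; lia.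
Qed.

(** The output is produced from its end: [Cat] runs its second part first, and [For] runs
    downwards. *)
Lemma run_gen_compile g d s B : clean d s -> pos s = 0 ->
    (forall x, env s x <= B) -> size w <= B ->
  run (gen_compile g d) s (gen_time_bound g B)
      (Store (cnt s) (pos s) (gen_eval w (env s) g ++ out s)).
Proof.
elim: g d s B => [e|g IHg h IHh|x a g IHg] d s B cs p0 eB wB /=.
- have cd := cs d (leqnn _); have he := eval_bound e eB wB.
  apply: run_seq; first exact: run_compile.
  set v := eval w _ e; pose s1 i := Store (upd (cnt s) (sreg d) i) (pos s) ((0 < v) :: out s).
  apply: (@run_seq _ _ _ _ (s1 v)).
    exists 2 => //; rewrite /s1; case: (posnP v) => [->|v0].
      by apply: EIfF; [rewrite /= /upd eqxx|apply: exec_eq; first exact: EOut].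
    by apply: EIfT; [rewrite /= /upd eqxx|apply: exec_eq; first exact: EOut].
  pose F i := s1 (v - i).
  have -> : s1 v = F 0 by rewrite /F subn0.
  rewrite (_ : Store _ _ _ = F v); last by rewrite /F subnn /s1; store_eq.
  apply: (@run_le _ _ _ (v * 2 + 1)); last by lia.
  apply: run_while => [i hi|]; last by lookup.
  split; first by lookup.
  exists 1 => //; apply: exec_eq; first by apply: EDec; lookup.
  by rewrite /F /s1; store_eq.
- apply: run_seq; first exact: IHh.
  by rewrite -catA; apply: IHg.
- have ha := eval_bound a eB wB.
  apply: run_seq; first exact: run_compile.
  set n := eval w (env s) a; set T := gen_time_bound g _.
  pose val i := gen_eval w (upd (env s) x i) g.
  pose F k := Store (upd (cnt s) (sreg d) n) (pos s)
    (flatten [seq val i | i <- iota (n - k) k] ++ out s).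
  have cd0 := cs d (leqnn _); have cd1 := cs d.+1 (leqnSn _).
  set s1 := setc s (sreg d) n.
  have F0 : F 0 = s1 by rewrite /F /s1; store_eq.
  have body k : k < n -> run (gen_compile g d.+2)
      (setc (setc (setc (F k) (sreg d) 0) (sreg d.+1) (cnt s1 (vreg x)))
        (vreg x) (n - k.+1))
      T
      (setc (setc (setc (F k.+1) (sreg d) 0) (sreg d.+1) (cnt s1 (vreg x)))
        (vreg x) (n - k.+1)).
    move=> kn; set s2 := setc _ _ _.
    have es2 : env s2 = upd (env s) x (n - k.+1) by rewrite /s2 env_set_var.
    have eB2 : forall y, env s2 y <= B + value_bound a B.
      move=> y; rewrite es2 /upd; case: eqP => _; first by lia.
      by have := eB y; lia.
    have wB2 : size w <= B + value_bound a B by lia.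
    have := IHg d.+2 s2 _ _ p0 eB2 wB2.
    have cs2 : clean d.+2 s2.
      move=> j hj; rewrite /s2 /= /upd /= !xpair_eqE /=.
      by do 2! (rewrite gtn_eqF /=; last by lia); apply: cs; lia.
    move=> /(_ cs2); congr run; rewrite es2; store_eq.
    by rewrite -subSn // subSS catA.
  have := run_loop F0 _ _ body.
  have e1 : cnt s1 (sreg d) = n by rewrite /s1 /= /upd eqxx.
  have e2 : cnt s1 (sreg d.+1) = 0 by rewrite /s1; rewrite /= /upd xpair_eqE gtn_eqF.
  move=> /(_ e1 e2).
  set s5 := setc _ _ _; set s6 := Store _ _ _ => h.
  have -> : s6 = s5.
    by rewrite /s6 /s5 /F; store_eq; rewrite subnn.
  apply: run_le h _; rewrite /loop_bound.
  have := eB x; have hm := leq_mul ha (leqnn (T + 2)).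
  by rewrite /s1 /env /= /upd /=; rewrite -/n in ha hm; lia.
Qed.

End CompileExpr.

Lemma poly_time_gen (g : gen) : poly_time (fun w => gen_eval w (fun _ => 0) g).
Proof.
apply: (@poly_time_exec _ (gen_compile g 0) (gen_time_bound g)) => [|w].
  exact: poly_bounded_gen_time.
have cl : clean 0 store0 by [].
have [t h e] := run_gen_compile g cl (erefl _) (fun x => leq0n (size w)) (leqnn _).
by eexists; last (exists t; [exact: h|exact: e]); rewrite /= cats0.
Qed.

(** * Derived operations and predicates on terms *)

Fixpoint fresh (e : expr) : nat :=
  match e with
  | Var x => x.+1
  | Cst _ | Size => 0
  | Add a b | Sub a b => maxn (fresh a) (fresh b)
  | Bitat a => fresh a
  | Sum x a b => maxn x.+1 (maxn (fresh a) (fresh b))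
  end.

Lemma eval_ext w e env1 env2 : (forall y, y < fresh e -> env1 y = env2 y) ->
  eval w env1 e = eval w env2 e.
Proof.
elim: e env1 env2 => [x|n||a IHa b IHb|a IHa b IHb|a IHa|x a IHa b IHb] e1 e2 /= h //.
- exact: h.
- by rewrite (IHa e1 e2) ?(IHb e1 e2) // => y hy; apply: h; lia.
- by rewrite (IHa e1 e2) ?(IHb e1 e2) // => y hy; apply: h; lia.
- by rewrite (IHa e1 e2).
- rewrite (IHa e1 e2) => [|y hy]; last by apply: h; lia.
  apply: eq_bigr => i _; apply: IHb => y hy; rewrite /upd.
  by case: eqP => // _; apply: h; lia.
Qed.

Lemma eval_upd_fresh w e env x i : fresh e <= x ->
  eval w (upd env x i) e = eval w env e.
Proof.
by move=> h; apply: eval_ext => y hy; rewrite /upd; case: eqP => // e'; lia.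
Qed.

Lemma eval_Add w env a b : eval w env (Add a b) = eval w env a + eval w env b.
Proof. by []. Qed.

Lemma eval_Sub w env a b : eval w env (Sub a b) = eval w env a - eval w env b.
Proof. by []. Qed.

Lemma eval_Cst w env n : eval w env (Cst n) = n.
Proof. by []. Qed.

Lemma eval_Size w env : eval w env Size = size w.
Proof. by []. Qed.

Lemma eval_Bitat w env a : eval w env (Bitat a) = nth false w (eval w env a).
Proof. by []. Qed.

Lemma eval_Var w env x : eval w env (Var x) = env x.
Proof. by []. Qed.

Lemma eval_Sum w env x a b : eval w env (Sum x a b) =
  \sum_(i < eval w env a) eval w (upd env x i) b.
Proof. by []. Qed.

(** The summation variable is fresh for [b], so the summand is constant; [a] is evaluated outside
    the scope of that variable. *)
Definition Mul (a b : expr) : expr := Sum (fresh b) a b.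

Lemma eval_Mul w env a b : eval w env (Mul a b) = eval w env a * eval w env b.
Proof.
rewrite /= (eq_bigr (fun=> eval w env b)) => [|i _]; last exact: eval_upd_fresh.
by rewrite sum_nat_const card_ord.
Qed.

Definition Not (a : expr) : expr := Sub (Cst 1) a.
Definition And (a b : expr) : expr := Mul a b.
Definition Or (a b : expr) : expr := Add a b.
Definition Lt (a b : expr) : expr := Sub b a.
Definition Le (a b : expr) : expr := Sub (Add b (Cst 1)) a.
Definition Eq : expr -> expr -> expr :=
  locked (fun a b => And (Le a b) (Le b a)).
Definition Ex (x : nat) (a b : expr) : expr := Sum x a b.
Definition All : nat -> expr -> expr -> expr :=
  locked (fun x a b => Not (Sum x a (Not b))).
Definition Bool (b : bool) : expr := Cst b.

Definition istrue (w : bits) (env : nat -> nat) (e : expr) : bool :=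
  0 < eval w env e.

Section Truth.

Variables (w : bits) (env : nat -> nat).

Lemma istrue_Not a : istrue w env (Not a) = ~~ istrue w env a.
Proof. by rewrite /istrue /= subn_gt0 -leqNgt; case: (eval _ _ _). Qed.

(** Double negation normalizes a truth value to 0 or 1, so that a sum of such terms counts. *)
Lemma eval_Not_Not a : eval w env (Not (Not a)) = istrue w env a.
Proof. by rewrite /istrue /=; case: (eval _ _ _). Qed.

Lemma istrue_And a b : istrue w env (And a b) = istrue w env a && istrue w env b.
Proof. by rewrite /istrue eval_Mul muln_gt0. Qed.

Lemma istrue_Or a b : istrue w env (Or a b) = istrue w env a || istrue w env b.
Proof. by rewrite /istrue /= addn_gt0. Qed.

Lemma istrue_Lt a b : istrue w env (Lt a b) = (eval w env a < eval w env b).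
Proof. by rewrite /istrue /= subn_gt0. Qed.

Lemma istrue_Le a b : istrue w env (Le a b) = (eval w env a <= eval w env b).
Proof. by rewrite /istrue /= subn_gt0 addn1. Qed.

Lemma istrue_Eq a b : istrue w env (Eq a b) = (eval w env a == eval w env b).
Proof. by rewrite /Eq -lock istrue_And !istrue_Le eqn_leq. Qed.

Lemma istrue_Bitat a : istrue w env (Bitat a) = nth false w (eval w env a).
Proof. by rewrite /istrue /=; case: nth. Qed.

Lemma istrue_Bool b : istrue w env (Bool b) = b.
Proof. by rewrite /istrue /=; case: b. Qed.

End Truth.

Lemma istrue_Ex w env x a b : istrue w env (Ex x a b) =
  [exists i : 'I_(eval w env a), istrue w (upd env x i) b].
Proof.
rewrite /istrue /= lt0n sum_nat_eq0 negb_forall.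
by apply: eq_existsb => i; rewrite implyTb -lt0n.
Qed.

Lemma istrue_All w env x a b : istrue w env (All x a b) =
  [forall i : 'I_(eval w env a), istrue w (upd env x i) b].
Proof.
rewrite /All -lock istrue_Not [istrue _ _ _](istrue_Ex _ _ x a (Not b)) negb_exists.
by apply: eq_forallb => i; rewrite istrue_Not negbK.
Qed.

Lemma sum_ltn n m : \sum_(i < n) (i < m) = minn n m.
Proof.
elim: n => [|n IH]; first by rewrite big_ord0 min0n.
by rewrite big_ord_recr /= IH; lia.
Qed.

(** Counts the positive multiples of [b] up to [a]. The conjunct [b] makes the quotient by zero
    equal to zero, as for [%/]. *)
Definition Div (a b : expr) : expr :=
  let x := maxn (fresh a) (fresh b) in
  Sum x a (Not (Not (And b (Le (Mul (Add (Var x) (Cst 1)) b) a)))).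

Lemma eval_Div w env a b : eval w env (Div a b) = eval w env a %/ eval w env b.
Proof.
rewrite /Div; set x := maxn _ _.
set n := eval w env a; set d := eval w env b.
have fa i : eval w (upd env x i) a = n by apply: eval_upd_fresh; rewrite leq_maxl.
have fb i : eval w (upd env x i) b = d by apply: eval_upd_fresh; rewrite leq_maxr.
have h i : eval w (upd env x i)
    (Not (Not (And b (Le (Mul (Add (Var x) (Cst 1)) b) a)))) = (i < n %/ d).
  rewrite eval_Not_Not istrue_And istrue_Le eval_Mul /= fa fb.
  rewrite /istrue fb /upd eqxx addn1; congr nat_of_bool.
  case: (posnP d) => [->|d0]; first by rewrite divn0.
  by rewrite leq_divRL.
transitivity (\sum_(i < n) nat_of_bool (i < n %/ d)); first by apply: eq_bigr => i _; exact: h.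
by rewrite sum_ltn; apply/minn_idPr; apply: leq_div.
Qed.

Definition Mod (a b : expr) : expr := Sub a (Mul (Div a b) b).

Lemma eval_Mod w env a b : eval w env (Mod a b) = eval w env a %% eval w env b.
Proof.
rewrite /Mod eval_Sub eval_Mul eval_Div.
by rewrite {1}(divn_eq (eval w env a) (eval w env b)) addKn.
Qed.

Definition Exp (a : expr) (d : nat) : expr := iter d (Mul a) (Cst 1).

Lemma eval_Exp w env a d : eval w env (Exp a d) = eval w env a ^ d.
Proof. by elim: d => [|d IH] //; rewrite expnS -IH -eval_Mul. Qed.

Definition PolyBound (c d : nat) (a : expr) : expr :=
  Add (Mul (Cst c) (Exp a d)) (Cst c).

Lemma eval_PolyBound w env c d a :
  eval w env (PolyBound c d a) = poly_bound c d (eval w env a).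
Proof. by rewrite /PolyBound eval_Add eval_Mul eval_Exp. Qed.

Definition evalE := (eval_Add, eval_Sub, eval_Cst, eval_Size, eval_Bitat,
  eval_Var, eval_Mul, eval_Div, eval_Mod, eval_Exp, eval_PolyBound).

Definition istrueE := (istrue_Not, istrue_And, istrue_Or, istrue_Lt, istrue_Le,
  istrue_Eq, istrue_Bitat, istrue_Bool, istrue_Ex, istrue_All).

Opaque Mul Div Mod Exp PolyBound Not And Or Lt Le Eq Ex All Bool.

Definition BigOr (T : Type) (s : seq T) (f : T -> expr) : expr :=
  foldr Or (Bool false) [seq f x | x <- s].

Lemma istrue_BigOr w env T (s : seq T) f :
  istrue w env (BigOr s f) = has (fun x => istrue w env (f x)) s.
Proof.
by rewrite /BigOr; elim: s => [|x s IH] /=; rewrite istrueE ?IH.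
Qed.

Lemma flatten_seq1 (S T : Type) (h : S -> T) s :
  flatten [seq [:: h x] | x <- s] = [seq h x | x <- s].
Proof. by elim: s => //= x s ->. Qed.

(** * Colourings and the block gadget *)

(** The colour of a vertex is the index of its block in [enum P]. Conversely, the colour classes
    form the partition: since all colours are used they are nonempty and pairwise distinct, and as
    there are at least two of them none is the whole vertex set. *)
Lemma P3_convex_partition_coloring p (G : sgraph) : 2 <= p ->
  has_P3_convex_partition p G <->
  exists c : vertex G -> 'I_p, (forall k, exists u, c u = k) /\
    forall u v w, u != w -> adj u v -> adj v w -> c u = c w -> c v = c u.
Proof.
move=> p2; split.
- case=> P [/and3P[/eqP cP tP P0] sP hP].
  have uP u : u \in cover P by rewrite cP.
  have bP u : pblock P u \in P by rewrite pblock_mem.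
  have ltp u : index (pblock P u) (enum P) < p.
    by rewrite -sP cardE index_mem mem_enum.
  exists (fun u => Ordinal (ltp u)); split=> [k|u v w uw auv avw [e]].
    have kP : k < size (enum P) by rewrite -cardE sP.
    have nP : nth set0 (enum P) k \in P by rewrite -mem_enum mem_nth.
    have /set0Pn[u us] : nth set0 (enum P) k != set0.
      by apply: contraNneq P0 => <-.
    by exists u; apply: val_inj; rewrite /= (def_pblock tP nP us) index_uniq ?enum_uniq.
  have e' : pblock P u = pblock P w.
    rewrite -(nth_index set0 (_ : pblock P u \in enum P)) ?mem_enum // e.
    by rewrite nth_index ?mem_enum.
  have [cS _] := hP _ (bP u).
  have vS : v \in pblock P u.
    by apply: (cS u v w) => //; rewrite ?mem_pblock // e' mem_pblock.
  by apply: val_inj; rewrite /= (def_pblock tP (bP u) vS).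
- case=> c [surj conv].
  pose F (k : 'I_p) := [set u | c u == k].
  have Finj : injective F.
    move=> k k' e; have [u uk] := surj k.
    have : u \in F k by rewrite inE uk.
    by rewrite e inE uk => /eqP.
  exists [set F k | k in 'I_p]; split; last first.
  + move=> _ /imsetP[k _ ->]; split=> [u v w uw auv avw|].
      by rewrite !inE => /eqP <- /eqP cw; apply/eqP; apply: conv avw _.
    have [k' kk'] : exists k' : 'I_p, k' != k.
      have h0 : 0 < p by lia.
      case: (eqVneq k (Ordinal h0)) => [->|h]; last by exists (Ordinal h0); rewrite eq_sym.
      by exists (Ordinal p2).
    have [u uk'] := surj k'; apply/eqP => /setP/(_ u).
    by rewrite !inE uk' (negbTE kk').
  + by rewrite card_imset // card_ord.
  apply/and3P; split.
  + apply/eqP/setP => u; rewrite inE; apply/bigcupP.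
    by exists (F (c u)); rewrite ?imset_f // inE.
  + apply/trivIsetP => _ _ /imsetP[k _ ->] /imsetP[k' _ ->] kk'.
    rewrite -setI_eq0; apply/eqP/setP => u; rewrite !inE.
    by apply/andP => -[/eqP e /eqP e']; case/eqP: kk'; rewrite -e -e'.
  + apply/imsetP => -[k _] /setP e; have [u uk] := surj k.
    by have := e u; rewrite !inE uk eqxx.
Qed.

Section Gadget.

Variables (NB NK : nat) (inc : nat -> nat -> nat -> bool).

(** The vertex number [(X * 2 + s) * NK + k] has the coordinates block [X], side [s] and index
    [k]. *)
Definition blk (u : nat) := u %/ NK %/ 2.
Definition side (u : nat) := odd (u %/ NK).
Definition idx (u : nat) := u %% NK.

(** Edges are oriented from side [true] to side [false]: the centre of a constraint lies on side
    [true], its neighbours on side [false]. Hence the sides are a bipartition. *)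
Definition gadget_half (u v : nat) : bool :=
  [&& side u, ~~ side v & (blk u == blk v) ||
     ((idx u == idx v) && inc (idx u) (blk u) (blk v))].

Definition gadget_adj (u v : nat) : bool := gadget_half u v || gadget_half v u.

Lemma gadget_sym (n : nat) : symmetric (fun u v : 'I_n => gadget_adj u v).
Proof. by move=> u v; rewrite /gadget_adj orbC. Qed.

Lemma gadget_irr (n : nat) : irreflexive (fun u v : 'I_n => gadget_adj u v).
Proof. by move=> u; rewrite /gadget_adj /gadget_half; case: (side u). Qed.

(* Each block [X] carries a complete bipartite graph on [2 * NK] vertices; these
   are rigid if [NK] exceeds the number of colours.  The constraint [k] with
   centre [X] joins the [k]-th vertex on one side of [X] to the [k]-th vertex on
   the other side of every [Y] with [inc k X Y]. *)
Definition gadget : sgraph :=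
  SGraph (@gadget_sym (NB * 2 * NK)) (@gadget_irr (NB * 2 * NK)).

Lemma gadget_bipartite : bipartite gadget.
Proof.
exists (fun u => side u) => u v; rewrite /= /gadget_adj /gadget_half.
by case: (side u); case: (side v).
Qed.

Definition vtx (X : nat) (s : bool) (k : nat) := (X * 2 + s) * NK + k.

Lemma vtx_lt X s k : X < NB -> k < NK -> vtx X s k < NB * 2 * NK.
Proof. by rewrite /vtx; case: s => /=; nia. Qed.

Lemma blk_vtx X s k : k < NK -> blk (vtx X s k) = X.
Proof.
move=> h; rewrite /blk /vtx divnMDl ?(divn_small h); last by lia.
by rewrite addn0 divnMDl // divn_small ?addn0 //; case: s.
Qed.

Lemma side_vtx X s k : k < NK -> side (vtx X s k) = s.
Proof.
move=> h; rewrite /side /vtx divnMDl ?(divn_small h); last by lia.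
by rewrite addn0 oddD muln2 odd_double /=; case: s.
Qed.

Lemma idx_vtx X s k : k < NK -> idx (vtx X s k) = k.
Proof. by move=> h; rewrite /idx /vtx modnMDl modn_small. Qed.

Lemma vtxE u : 0 < NK -> u = vtx (blk u) (side u) (idx u).
Proof.
move=> h; rewrite /vtx /blk /side /idx divn2.
have := odd_double_half (u %/ NK); rewrite -muln2 addnC => ->.
exact: divn_eq.
Qed.

Lemma blk_lt u : u < NB * 2 * NK -> blk u < NB.
Proof.
move=> h; have k0 : 0 < NK by lia.
by rewrite /blk !ltn_divLR.
Qed.

(** Blocks are rigid: among more than [p] vertices of one side two share a colour, they force it on
    the other side, and two vertices there force it back. By [inc_uniq] a vertex of side [false] has
    at most one neighbour outside its block, so a path that leaves the block of its middle vertex in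
    both directions has a constraint centre in the middle. *)
Lemma gadget_partition p : 2 <= p -> p < NK ->
    (forall k X X' Y, inc k X Y -> inc k X' Y -> X = X') ->
  has_P3_convex_partition p gadget <->
  exists c : nat -> nat, [/\ forall X, X < NB -> c X < p,
    forall j, j < p -> exists2 X, X < NB & c X = j &
    forall k X Y Z, k < NK -> X < NB -> Y < NB -> Z < NB ->
      Y != Z -> inc k X Y -> inc k X Z -> c Y = c Z -> c X = c Y].
Proof.
move=> p2 pK inc_uniq; have K0 : 0 < NK by lia.
rewrite P3_convex_partition_coloring //; split.
- case=> c [surj conv].
  pose v X s k (hX : X < NB) (hk : k < NK) : vertex gadget := Ordinal (vtx_lt s hX hk).
  have adjT X k X' k' (hX : X < NB) (hk : k < NK) (hX' : X' < NB) (hk' : k' < NK) :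
      adj (v X true k hX hk) (v X' false k' hX' hk') = (X == X') || ((k == k') && inc k X X').
    by rewrite /= /gadget_adj /gadget_half /= !side_vtx // !blk_vtx // !idx_vtx //= orbF.
  have adjC (x y : vertex gadget) : adj x y = adj y x by exact: adj_sym.
  have vE (x y : vertex gadget) : x != y -> val x != val y by [].
  have vneq X s k k' hX hk hk' : k != k' -> v X s k hX hk != v X s k' hX hk'.
    apply: contra => /eqP/(congr1 val)/(congr1 idx).
    by rewrite /= !idx_vtx // => ->.
  have rigid X (hX : X < NB) : exists j, forall s k (hk : k < NK), c (v X s k hX hk) = j.
    have [k1 [k2 k12 e]] : exists k1, exists2 k2, k1 != k2 &
        c (v X true (val k1) hX (ltn_ord k1)) = c (v X true (val k2) hX (ltn_ord k2)).
      apply/injectivePn/negP => /injectiveP/leq_card.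
      by rewrite !card_ord; lia.
    set j := c _ in e; exists j.
    have hF k (hk : k < NK) : c (v X false k hX hk) = j.
      apply: (conv (v X true k1 hX (ltn_ord k1)) _ (v X true k2 hX (ltn_ord k2)));
        rewrite -?e //; first exact: vneq.
      + by rewrite adjT eqxx.
      + by rewrite adjC adjT eqxx.
    have h1 : 1 < NK by lia.
    case=> k hk; last exact: hF.
    rewrite -(hF 0 K0).
    apply: (conv (v X false 0 hX K0) _ (v X false 1 hX h1)); rewrite ?hF //; first exact: vneq.
    + by rewrite adjC adjT eqxx.
    + by rewrite adjT eqxx.
  (* The match supplies the proof that [X] is a block, from which a vertex is built; elsewhere the
     value is arbitrary. *)
  pose cb X : nat := if ltnP X NB is LtnNotGeq h then c (v X true 0 h K0) else 0.
  have cbE X s k (hX : X < NB) (hk : k < NK) : cb X = c (v X s k hX hk).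
    rewrite /cb; case: ltnP => [h|]; last by lia.
    rewrite (bool_irrelevance h hX); have [j hj] := rigid X hX.
    by rewrite !hj.
  exists cb; split.
  + by move=> X hX; rewrite (cbE X true 0 hX K0).
  + move=> j hj; have [u uj] := surj (Ordinal hj).
    exists (blk u); first exact: blk_lt.
    rewrite (cbE _ (side u) (idx u) (blk_lt (ltn_ord u)) (ltn_pmod _ K0)).
    rewrite (_ : v _ _ _ _ _ = u) ?uj //.
    by apply: val_inj; rewrite /= -vtxE.
  + move=> k X Y Z hk hX hY hZ YZ iY iZ.
    rewrite (cbE _ false k hY hk) (cbE _ false k hZ hk) (cbE _ true k hX hk).
    move=> e; congr val; apply: (conv _ _ (v Z false k hZ hk)).
    * apply: contra YZ => /eqP/(congr1 val)/(congr1 blk).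
      by rewrite /= !blk_vtx // => ->.
    * by rewrite adjC adjT eqxx iY orbT.
    * by rewrite adjT eqxx iZ orbT.
    * exact: val_inj.
- case=> c [cp surj conv].
  have hc (u : vertex gadget) : c (blk u) < p by apply: cp; exact: blk_lt.
  exists (fun u => Ordinal (hc u)); split.
    move=> j; have [X hX cX] := surj j (ltn_ord j).
    exists (Ordinal (vtx_lt true hX K0)); apply: val_inj => /=.
    by rewrite blk_vtx.
  move=> u v w uw auv avw /(congr1 val) /= e; apply: val_inj => /=.
  (* An end in the block of [v] has the colour of [v], and the ends agree in colour; so both ends
     may be assumed to lie in other blocks. *)
  have [->//|uv] := eqVneq (blk u) (blk v).
  have [e2|vw] := eqVneq (blk w) (blk v); first by rewrite e e2.
  have uw' : val u = val w -> False by move=> /val_inj h; rewrite h eqxx in uw.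
  have uE := vtxE u K0; have wE := vtxE w K0.
  move: auv avw; rewrite /= /gadget_adj /gadget_half.
  rewrite [blk v == _]eq_sym [blk v == blk w]eq_sym (negbTE uv) (negbTE vw) /=.
  case sv: (side v); case su: (side u); case sw: (side w); rewrite //= ?orbF.
  (* The middle is a centre: its two neighbours agree in side and index, so they differ in the
     block. *)
  + move=> /andP[/eqP ei iu] /andP[/eqP ei' iw].
    have YZ : blk u != blk w.
      by apply/eqP => h; apply: uw'; rewrite /= uE wE su sw h -ei -ei'.
    apply: (conv (idx v)) YZ iu iw e; try exact: blk_lt.
    by rewrite ltn_pmod.
  (* The middle is not a centre: both ends are the one vertex joined to it from outside, contrary to
     [u != w]. *)
  + move=> /andP[/eqP ei iu] /andP[/eqP ei' iw].
    case: uw'; rewrite /= uE wE su sw ei ei'.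
    by rewrite ei in iu; rewrite ei' in iw; rewrite (inc_uniq _ _ _ _ iu iw).
Qed.

End Gadget.

(* A system of constraints on a grid of [A] positions: the variables are the pairs
   of a location and a position, the constraints the pairs of a kind and a
   position, and [ends] gives the centre and the neighbours of a constraint. *)
Record system := System {
  loc : finType;
  kind : finType;
  default_loc : loc;
  area : bits -> nat;
  guard : bits -> kind -> nat -> bool;
  ends : bits -> kind -> nat -> (loc * nat) * seq (loc * nat)
}.

(** * Graphs of constraint systems *)

Section System.

Variables (S : system) (p : nat).
Hypothesis p2 : 2 <= p.

Section Fixed.

Variable w : bits.

Notation A := (area S w).

Definition nblocks := #|loc S| * A.
(** The [p.+1] dummy kinds have no incidences; they make every block large enough to be rigid. *)
Definition nconstraints := (#|kind S| + p.+1) * A.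

Definition block_num (b : loc S * nat) : nat := enum_rank b.1 * A + b.2.

Definition incident (k X Y : nat) : bool :=
  has (fun c => [&& k %/ A == enum_rank c, guard w c (k %% A),
     X == block_num (ends w c (k %% A)).1 &
     Y \in [seq block_num b | b <- (ends w c (k %% A)).2]]) (enum (kind S)).

Definition system_graph : sgraph := gadget nblocks nconstraints incident.

Hypothesis A0 : 0 < A.
Hypothesis ends_lt : forall (c : kind S) q, q < A -> guard w c q ->
  forall b, b \in (ends w c q).1 :: (ends w c q).2 -> b.2 < A.

Lemma block_num_inj b1 b2 : b1.2 < A -> b2.2 < A ->
  block_num b1 = block_num b2 -> b1 = b2.
Proof.
case: b1 b2 => [l1 q1] [l2 q2] /= h1 h2 e; have := congr1 (divn^~ A) e.
rewrite /block_num !divnMDl // !divn_small // !addn0 => /ord_inj/enum_rank_inj el.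
have := congr1 (modn^~ A) e.
by move: el; rewrite /block_num !modnMDl !modn_small //= => -> ->.
Qed.

(** Blocks and constraints are numbered by a rank and a position modulo [A]. The number of a
    constraint determines its centre, which is the uniqueness demanded by the gadget. *)
Lemma system_partition :
  has_P3_convex_partition p system_graph <->
  exists C : loc S * nat -> nat, [/\ forall b, b.2 < A -> C b < p,
    forall j, j < p -> exists2 b, b.2 < A & C b = j &
    forall (c : kind S) q, q < A -> guard w c q ->
    forall b1 b2, b1 \in (ends w c q).2 -> b2 \in (ends w c q).2 -> b1 != b2 ->
      C b1 = C b2 -> C (ends w c q).1 = C b1].
Proof.
have num_lt b : b.2 < A -> block_num b < nblocks.
  move=> h; apply: (@leq_trans ((enum_rank b.1).+1 * A)).
    by rewrite /block_num mulSn; lia.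
  by rewrite /nblocks leq_mul2r ltn_ord orbT.
rewrite gadget_partition //; last first.
- move=> k X X' Y /hasP[c _ /and4P[/eqP kc _ /eqP -> _]].
  move=> /hasP[c' _ /and4P[/eqP kc' _ /eqP -> _]].
  by move: kc'; rewrite kc => /ord_inj/enum_rank_inj ->.
- by rewrite /nconstraints; nia.
split.
- case=> c [cp surj conv]; exists (c \o block_num); split=> /=.
  + by move=> b hb; apply/cp/num_lt.
  + move=> j /surj[X hX <-]; have hX' : X %/ A < #|loc S| by rewrite ltn_divLR.
    exists (enum_val (Ordinal hX'), X %% A); first by rewrite ltn_mod.
    by rewrite /block_num /= enum_valK /= -divn_eq.
  + move=> k q hq g b1 b2 h1 h2 b12.
    have lt0 := ends_lt hq g (mem_head _ _).
    have lt1 : b1.2 < A by apply: (ends_lt hq g); rewrite inE h1 orbT.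
    have lt2 : b2.2 < A by apply: (ends_lt hq g); rewrite inE h2 orbT.
    have hk : enum_rank k * A + q < nconstraints.
      apply: (@leq_trans ((enum_rank k).+1 * A)); first by rewrite mulSn; lia.
      by rewrite /nconstraints leq_mul2r (leq_trans (ltn_ord _) (leq_addr _ _)) orbT.
    have hinc b : b \in (ends w k q).2 ->
        incident (enum_rank k * A + q) (block_num (ends w k q).1) (block_num b).
      move=> hb; apply/hasP; exists k; first by rewrite mem_enum.
      by rewrite modnMDl modn_small // divnMDl // divn_small // addn0 !eqxx g map_f.
    apply: (conv _ _ _ _ hk); rewrite ?num_lt ?hinc //.
    by apply: contra b12 => /eqP/(block_num_inj lt1 lt2)/eqP.
- case=> C [Cp surj conv].
  pose dec X := (nth (default_loc S) (enum (loc S)) (X %/ A), X %% A).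
  have decK b : b.2 < A -> dec (block_num b) = b.
    case: b => l q /= h; rewrite /dec /block_num divnMDl // divn_small // addn0.
    by rewrite modnMDl modn_small // nth_enum_rank.
  exists (C \o dec); split=> /=.
  + by move=> X hX; apply: Cp; rewrite ltn_mod.
  + move=> j /surj[b hb <-]; exists (block_num b); first exact: num_lt.
    by rewrite decK.
  + move=> k X Y Z hk hX hY hZ YZ /hasP[c _ /and4P[/eqP kc g /eqP -> /mapP[b1 h1 eY]]].
    move=> /hasP[c' _ /and4P[/eqP kc' _ _ /mapP[b2 h2 eZ]]].
    move: kc' h2; rewrite kc => /ord_inj/enum_rank_inj <- h2.
    have hq : k %% A < A by rewrite ltn_mod.
    have lt1 : b1.2 < A by apply: (ends_lt hq g); rewrite inE h1 orbT.
    have lt2 : b2.2 < A by apply: (ends_lt hq g); rewrite inE h2 orbT.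
    rewrite eY eZ !decK // ?(ends_lt hq g) ?mem_head //.
    move=> e; apply: (conv _ _ hq g _ b2) => //.
    by apply: contra YZ => /eqP e'; rewrite eY eZ e'.
Qed.

End Fixed.

Variables (areaE : expr) (guardE : kind S -> expr -> expr).
Variable endsE : kind S -> expr -> (loc S * expr) * seq (loc S * expr).

Definition eval_loc w env (b : loc S * expr) := (b.1, eval w env b.2).

Hypothesis eval_areaE : forall w env, eval w env areaE = area S w.
Hypothesis istrue_guardE : forall w env c P,
  istrue w env (guardE c P) = guard w c (eval w env P).
Hypothesis eval_endsE : forall w env (c : kind S) P,
  ends w c (eval w env P) = (eval_loc w env (endsE c P).1,
     [seq eval_loc w env b | b <- (endsE c P).2]).

Let numE (b : loc S * expr) : expr :=
  Add (Mul (Cst (enum_rank b.1)) areaE) b.2.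

Let incE (K X Y : expr) : expr :=
  let Q := Mod K areaE in
  BigOr (enum (kind S)) (fun c =>
    And (Eq (Div K areaE) (Cst (enum_rank c)))
    (And (guardE c Q) (And (Eq X (numE (endsE c Q).1))
      (BigOr (endsE c Q).2 (fun b => Eq Y (numE b)))))).

Let NKE : expr := Mul (Cst (#|kind S| + p.+1)) areaE.
Let orderE : expr := Mul (Mul (Mul (Cst #|loc S|) areaE) (Cst 2)) NKE.

Let halfE (U V : expr) : expr :=
  let blkE U := Div (Div U NKE) (Cst 2) in
  let sideE U := Mod (Div U NKE) (Cst 2) in
  And (Lt (Cst 0) (sideE U)) (And (Eq (sideE V) (Cst 0))
   (Or (Eq (blkE U) (blkE V))
     (And (Eq (Mod U NKE) (Mod V NKE)) (incE (Mod U NKE) (blkE U) (blkE V))))).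

Let adjE : expr := Or (halfE (Var 0) (Var 1)) (halfE (Var 1) (Var 0)).

Let istrue_incE w env K X Y : istrue w env (incE K X Y) =
  incident w (eval w env K) (eval w env X) (eval w env Y).
Proof.
rewrite /incE istrue_BigOr; apply: eq_has => c.
have numEE b : eval w env (numE b) = block_num w (eval_loc w env b).
  by rewrite /numE !evalE eval_areaE.
rewrite !istrueE istrue_guardE numEE !evalE eval_areaE.
have := eval_endsE w env c (Mod K areaE); rewrite !evalE eval_areaE => -> /=.
congr [&& _, _, _ & _]; rewrite istrue_BigOr.
elim: (endsE _ _).2 => [|b s IH] //=.
by rewrite IH inE istrueE numEE.
Qed.

Let istrue_halfE w env U V : istrue w env (halfE U V) =
  gadget_half (nconstraints w) (incident w) (eval w env U) (eval w env V).
Proof.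
have nkE : eval w env NKE = nconstraints w by rewrite /NKE !evalE eval_areaE.
rewrite /halfE /gadget_half !istrueE istrue_incE !(nkE, evalE) !modn2.
by rewrite lt0b eqb0.
Qed.

(** The generator follows the encoding: the unary order, then a double loop in which the variables 0
    and 1 are the row and the column. *)
Lemma poly_time_system : poly_time (fun w => encode_graph (system_graph w)).
Proof.
pose g := Cat (For 0 orderE (Emit (Cst 1)))
  (Cat (Emit (Cst 0)) (For 0 orderE (For 1 orderE (Emit adjE)))).
have [M [c [d h]]] := poly_time_gen g; exists M, c, d => w.
have [t tb e] := h w; exists t => //; move: e => /=.
suff -> : encode_graph (system_graph w) = gen_eval w (fun=> 0) g by [].
have oE env : eval w env orderE = order (system_graph w).
  by rewrite /orderE /NKE !evalE eval_areaE.
rewrite /encode_graph /g /= !oE; congr (_ ++ _ :: _).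
  rewrite (flatten_seq1 (fun=> true)) -(size_iota 0 (nblocks w * 2 * _)).
  by elim: (iota _ _) => //= _ s ->.
rewrite -val_enum_ord -map_comp; congr flatten; apply: eq_map => u /=.
rewrite oE -val_enum_ord -map_comp.
rewrite (flatten_seq1 (fun v : vertex (system_graph w) => 0 < eval w _ adjE)).
apply: eq_map => v.
rewrite -[RHS]/(istrue w _ adjE) istrue_Or !istrue_halfE.
by rewrite !evalE /upd.
Qed.

End System.

(** * The tableau of a computation *)

Lemma leq_poly_bound c d m n : m <= n -> poly_bound c d m <= poly_bound c d n.
Proof.
move=> mn; rewrite leq_add2r leq_mul2l; case: d => [|d]; first by rewrite leqnn orbT.
by rewrite leq_exp2r // mn orbT.
Qed.

Lemma size_pair_bits x y : size (pair_bits x y) = 2 * size x + 1 + size y.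
Proof.
rewrite /pair_bits size_cat /=; elim: x => [|b x IH] /=; first by lia.
by move: IH; lia.
Qed.

Lemma nth_pair_bits x y m : nth false (pair_bits x y) m =
  if m < 2 * size x then (m %% 2 == 0) || nth false x (m %/ 2)
  else if m == 2 * size x then false else nth false y (m - (2 * size x).+1).
Proof.
elim: x m => [|b x IH] m; first by case: m => [|m] //=; rewrite subn1.
have h : 1 < 2 * size (b :: x) by rewrite /=; lia.
case: m => [|[|m]]; [by rewrite (ltnW h)|by rewrite h|].
have -> : nth false (pair_bits (b :: x) y) m.+2 = nth false (pair_bits x y) m by [].
rewrite IH (_ : (m.+2 < 2 * size (b :: x)) = (m < 2 * size x)); last by rewrite /=; lia.
rewrite (_ : (m.+2 == 2 * size (b :: x)) = (m == 2 * size x)); last by rewrite /=; lia.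
have -> : m.+2 - (2 * size (b :: x)).+1 = m - (2 * size x).+1 by rewrite /=; lia.
have -> : m.+2 %% 2 = m %% 2 by rewrite -addn2 modnDr.
by have -> : m.+2 %/ 2 = (m %/ 2).+1 by rewrite -addn2 divnDr // addn1.
Qed.

(** * Tapes seen from the head *)

Section Tapes.

Variables (S : Type) (m : nat).
Hypothesis m0 : 0 < m.

(* The contents of the cell at distance [z - m] from the head. *)
Definition cell_at (tp : tape S) (z : nat) : cell S :=
  if z < m then nth None (lft tp) (m - z.+1) else nth None (cur tp :: rgt tp) (z - m).

(** When the head moves, the cell at [z] is found at [z + shift mv - 1]; the offset 1 keeps the
    displacement a natural number. *)
Definition shift (mv : move) : nat :=
  match mv with MoveL => 2 | Stay => 1 | MoveR => 0 end.

Lemma cell_at_head tp : cell_at tp m = cur tp.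
Proof. by rewrite /cell_at ltnn subnn. Qed.

(** The hypothesis excludes the cell at 0 when the head moves right, as this cell leaves the
    window. *)
Lemma cell_at_move tp a z : 0 < z + shift a.2 ->
  cell_at (write_move tp a) (z + shift a.2 - 1) =
  if z == m then a.1 else cell_at tp z.
Proof.
case: tp => l c r; case: a => b mv /= hz; rewrite /cell_at.
have sub_succ i j : j < i -> i - j = (i - j.+1).+1 by lia.
case: mv hz => /= hz.
- have -> : z + 2 - 1 = z.+1 by lia.
  case: (ltngtP z m) => h.
  + case: (ltnP z.+1 m) => h1; first by rewrite nth_behead (sub_succ m z.+1).
    have -> : z.+1 - m = 0 by lia.
    have -> : m - z.+1 = 0 by lia.
    by rewrite nth0.
  + rewrite ifF; last by lia.
    rewrite subSn ?(ltnW h) //=.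
    by rewrite (sub_succ z m).
  + by rewrite h ltnNge leqnSn /= subSn // subnn.
- rewrite addnK; case: (ltngtP z m) => h //; first by rewrite (sub_succ z m).
  by rewrite h subnn.
- rewrite addn0; case: (ltngtP z m) => h.
  + rewrite ifT; last by lia.
    have -> : (z - 1).+1 = z by lia.
    by rewrite (sub_succ m z).
  + rewrite ifF; last by lia.
    case: (eqVneq z m.+1) => [->|ne2]; first by rewrite subn1 /= subnn subSnn /= nth0.
    have h3 : m.+1 < z by lia.
    rewrite (sub_succ z m) // (sub_succ z m.+1) //=.
    by rewrite (_ : z - 1 - m = (z - m.+2).+1) /= ?nth_behead //; lia.
  + rewrite h ifT; last by lia.
    by rewrite (_ : m - (m - 1).+1 = 0) //; lia.
Qed.

Definition is_bit (a : cell S) : bool := if a is Some (inl _) then true else false.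

(** Acceptance becomes a condition on two cells: the output ends at the first non-bit, so the cell
    after the head is tested as well. *)
Lemma bits_of_tape_true tp : bits_of_tape tp = [:: true] <->
  cell_at tp m = Some (inl true) /\ ~~ is_bit (cell_at tp m.+1).
Proof.
case: tp => l c r.
rewrite /cell_at ltnn ltnNge leqnSn /= subnn subSn // subnn /bits_of_tape /=.
case: c => [[b|s]|] //=; try by split=> // -[].
case: r => [|[[b'|s]|] r] /=; split; try by case=> // -[->].
all: by case=> ->.
Qed.

End Tapes.

Section Tableau.

Variables (p' : nat) (M : TM) (cs ds ct dt : nat).

Notation p := p'.+2.
Notation symbol := (cell (symb M)).
Notation scan := {ffun tidx M -> symbol}.
Notation local := (state M * {ffun tidx M -> symbol})%type.
Notation K := #|tidx M|.

(** Extends the transition function to halting states by an idle step, so that all steps have one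
    form. *)
Definition action (g : local) : state M * {ffun tidx M -> symbol * move} :=
  if halted g.1 then (g.1, [ffun i => (g.2 i, Stay)]) else delta g.1 g.2.

Definition local_of (c : config M) : local := (c.1, [ffun i => cur (c.2 i)]).

Lemma stepE (c : config M) : step c = ((action (local_of c)).1,
  [ffun i => write_move (c.2 i) ((action (local_of c)).2 i)]).
Proof.
rewrite /step /action /=; case: ifP => // _; case: c => q T /=; congr pair.
by apply/ffunP => i; rewrite !ffunE; case: (T i).
Qed.

(* [Prefix g j] at time [t]: the state is [g.1] and the first [j] heads scan the
   symbols given by [g.2].  [Cell i a] at [(t, z)]: on tape [i], the cell at
   distance [z - mid] from the head contains [a].  [Carry g i a] at [(t, z)] is
   the conjunction of [Prefix g ord_max] and [Cell i a], and [Choice] states that the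
   input tape contains a bit. *)
Inductive location :=
| Const of 'I_p
| Prefix of local & 'I_K.+1
| Cell of tidx M & symbol
| Carry of local & tidx M & symbol
| Choice.

(** [Distinct] and [TwoValued] fix the truth values. [Scan] collects the scanned symbols head by
    head, [Next] passes the state on, and [CarryDef], [Shift] and [Write] pass on the cells. The
    remaining kinds describe the first row, the guessed certificate and acceptance. *)
Inductive constr :=
| Distinct of location & 'I_p & 'I_p
| TwoValued of location & 'I_p
| Scan of local & 'I_K
| Next of local & local
| CarryDef of local & tidx M & symbol
| Shift of local & tidx M & symbol
| Write of local & tidx M
| StartState of local
| StartCell of tidx M & symbol
| GuessBit | GuessAny | GuessEnd
| Accept of symbol.

Definition location_code (l : location) :=
  match l with
  | Const j => inl j
  | Prefix g j => inr (inl (g, j))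
  | Cell i a => inr (inr (inl (i, a)))
  | Carry g i a => inr (inr (inr (inl (g, i, a))))
  | Choice => inr (inr (inr (inr tt)))
  end.

Definition location_decode c :=
  match c with
  | inl j => Const j
  | inr (inl (g, j)) => Prefix g j
  | inr (inr (inl (i, a))) => Cell i a
  | inr (inr (inr (inl (g, i, a)))) => Carry g i a
  | inr (inr (inr (inr tt))) => Choice
  end.

Lemma location_codeK : cancel location_code location_decode.
Proof. by case. Qed.

HB.instance Definition _ := Finite.copy location (can_type location_codeK).

Definition constr_code (k : constr) :=
  match k with
  | Distinct l i j => inl (l, i, j)
  | TwoValued l j => inr (inl (l, j))
  | Scan g j => inr (inr (inl (g, j)))
  | Next g g' => inr (inr (inr (inl (g, g'))))
  | CarryDef g i a => inr (inr (inr (inr (inl (g, i, a)))))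
  | Shift g i a => inr (inr (inr (inr (inr (inl (g, i, a))))))
  | Write g i => inr (inr (inr (inr (inr (inr (inl (g, i)))))))
  | StartState g => inr (inr (inr (inr (inr (inr (inr (inl g)))))))
  | StartCell i a => inr (inr (inr (inr (inr (inr (inr (inr (inl (i, a)))))))))
  | Accept a => inr (inr (inr (inr (inr (inr (inr (inr (inr (inl a)))))))))
  | GuessBit => inr (inr (inr (inr (inr (inr (inr (inr (inr (inr None)))))))))
  | GuessAny => inr (inr (inr (inr (inr (inr (inr (inr (inr (inr (Some true))))))))))
  | GuessEnd => inr (inr (inr (inr (inr (inr (inr (inr (inr (inr (Some false))))))))))
  end.

Definition constr_decode c :=
  match c with
  | inl (l, i, j) => Distinct l i j
  | inr (inl (l, j)) => TwoValued l j
  | inr (inr (inl (g, j))) => Scan g j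
  | inr (inr (inr (inl (g, g')))) => Next g g'
  | inr (inr (inr (inr (inl (g, i, a))))) => CarryDef g i a
  | inr (inr (inr (inr (inr (inl (g, i, a)))))) => Shift g i a
  | inr (inr (inr (inr (inr (inr (inl (g, i))))))) => Write g i
  | inr (inr (inr (inr (inr (inr (inr (inl g))))))) => StartState g
  | inr (inr (inr (inr (inr (inr (inr (inr (inl (i, a))))))))) => StartCell i a
  | inr (inr (inr (inr (inr (inr (inr (inr (inr (inl a))))))))) => Accept a
  | inr (inr (inr (inr (inr (inr (inr (inr (inr (inr None))))))))) => GuessBit
  | inr (inr (inr (inr (inr (inr (inr (inr (inr (inr (Some true)))))))))) => GuessAny
  | inr (inr (inr (inr (inr (inr (inr (inr (inr (inr (Some false)))))))))) => GuessEnd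
  end.

Lemma constr_codeK : cancel constr_code constr_decode.
Proof. by case. Qed.

HB.instance Definition _ := Finite.copy constr (can_type constr_codeK).

Definition true_const : location := Const ord0.
Definition false_const : location := Const (lift ord0 ord0).

Section Dimensions.

Variable w : bits.

Definition cert_len := poly_bound cs ds (size w).
Definition word_len := 2 * size w + 1 + cert_len.
Definition time_lim := poly_bound ct dt word_len.
(** The window holds the whole input word to the right of the head. In addition, the reliable part
    of a row shrinks by one cell on either side per step, and after [time_lim] steps it must still
    contain the cells [mid] and [mid.+1]. *)
Definition mid := time_lim + 1 + word_len.
Definition width := 2 * mid + 1.
Definition grid_area := (time_lim + 1) * width.

Definition word_bit (m : nat) : bool := (m %% 2 == 0) || nth false w (m %/ 2).

(** The facts of the first row that hold for every certificate; on the input tape none concerns a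
    cell of [cert_cell]. *)
Definition start_cell (i : tidx M) (a : symbol) (z : nat) : bool :=
  if i == input M then
    match a with
    | None => (z < mid) || (mid + word_len <= z)
    | Some (inl true) =>
        [&& mid <= z, z < mid + 2 * size w & word_bit (z - mid)]
    | Some (inl false) => (z == mid + 2 * size w) ||
        [&& mid <= z, z < mid + 2 * size w & ~~ word_bit (z - mid)]
    | Some (inr _) => false
    end
  else a == None.

Definition cert_cell (t z : nat) : bool :=
  [&& t == 0, mid + 2 * size w < z & z < mid + word_len].

Definition is_const (l : location) : bool := if l is Const _ then true else false.

(** The symbols forbidden on the output tape in the last row. *)
Definition accept_cell (a : symbol) (z : nat) : bool :=
  (z == mid) && (a != Some (inl true)) || (z == mid.+1) && is_bit a.

Definition shift_of (g : local) (i : tidx M) : nat := shift ((action g).2 i).2.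

Definition grid_guard (k : constr) (q : nat) : bool :=
  let t := q %/ width in let z := q %% width in
  match k with
  | Distinct _ i j => i != j
  | TwoValued l j => (1 < j) && ~~ is_const l
  | Scan _ _ => z == mid
  | Next g g' => [&& z == mid, t < time_lim & g'.1 == (action g).1]
  | CarryDef _ _ _ => true
  | Shift g i _ => [&& t < time_lim, z != mid, 0 < z + shift_of g i &
                       z + shift_of g i <= width]
  | Write _ _ => (z == mid) && (t < time_lim)
  | StartState g => [&& t == 0, z == mid & g.1 == start M]
  | StartCell i a => (t == 0) && start_cell i a z
  | GuessBit | GuessAny | GuessEnd => cert_cell t z
  | Accept a => (t == time_lim) && accept_cell a z
  end.

(** For two-valued blocks the shapes mean: [(c; a, tt)] that [a] implies [c]; [(c; a, b, ff)] that
    [a] and [b] imply [c]; [(tt; a, ff)] that [a] holds; [(ff; a, tt)] that [a] fails; [(tt; a, b)]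
    that [a] or [b] holds; [(c; a, b, tt)] that [c] gives [a] or [b]. The constants are taken at
    position 0. *)
Definition grid_ends (k : constr) (q : nat) :
    (location * nat) * seq (location * nat) :=
  let tt := (true_const, 0) in let ff := (false_const, 0) in
  match k with
  | Distinct l i j => ((l, q), [:: (Const i, 0); (Const j, 0)])
  | TwoValued l j => (tt, [:: (Const j, 0); (l, q)])
  | Scan g j => ((Prefix g (lift ord0 j), q),
      [:: (Prefix g (widen_ord (leqnSn K) j), q);
          (Cell (enum_val j) (g.2 (enum_val j)), q); ff])
  | Next g g' => ((Prefix g' ord0, q + width), [:: (Prefix g ord_max, q); tt])
  | CarryDef g i a => ((Carry g i a, q),
      [:: (Prefix g ord_max, q %/ width * width + mid); (Cell i a, q); ff])
  | Shift g i a =>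
      ((Cell i a, q + width + shift_of g i - 1), [:: (Carry g i a, q); tt])
  | Write g i => ((Cell i ((action g).2 i).1, q + width + shift_of g i - 1),
      [:: (Prefix g ord_max, q); tt])
  | StartState g => (tt, [:: (Prefix g ord0, q); ff])
  | StartCell i a => (tt, [:: (Cell i a, q); ff])
  | GuessBit => ((Choice, q), [:: (Cell (input M) (Some (inl true)), q);
                                  (Cell (input M) (Some (inl false)), q); tt])
  | GuessAny => (tt, [:: (Choice, q); (Cell (input M) None, q)])
  | GuessEnd => ((Cell (input M) None, q + 1), [:: (Cell (input M) None, q); tt])
  | Accept a => (ff, [:: (Cell (output M) a, q); tt])
  end.

End Dimensions.

Definition grid : system := System true_const grid_area grid_guard grid_ends.

(** * The tableau described by terms *)

Definition cert_lenE := PolyBound cs ds Size.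
Definition word_lenE := Add (Add (Mul (Cst 2) Size) (Cst 1)) cert_lenE.
Definition time_limE := PolyBound ct dt word_lenE.
Definition midE := Add (Add time_limE (Cst 1)) word_lenE.
Definition widthE := Add (Mul (Cst 2) midE) (Cst 1).
Definition grid_areaE := Mul (Add time_limE (Cst 1)) widthE.

Section EvalDimensions.
Variables (w : bits) (env : nat -> nat).

Lemma eval_word_len : eval w env word_lenE = word_len w.
Proof. by rewrite /word_lenE !evalE. Qed.

Lemma eval_time_lim : eval w env time_limE = time_lim w.
Proof. by rewrite /time_limE !evalE. Qed.

Lemma eval_mid : eval w env midE = mid w.
Proof. by rewrite /midE eval_Add eval_word_len eval_Add eval_time_lim. Qed.

Lemma eval_width : eval w env widthE = width w.
Proof. by rewrite /widthE eval_Add eval_Mul eval_mid. Qed.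

Lemma eval_grid_area : eval w env grid_areaE = area grid w.
Proof. by rewrite /grid_areaE eval_Mul eval_width eval_Add eval_time_lim. Qed.

End EvalDimensions.

Definition word_bitE (m : expr) : expr :=
  Or (Eq (Mod m (Cst 2)) (Cst 0)) (Bitat (Div m (Cst 2))).

Definition start_cellE (i : tidx M) (a : symbol) (z : expr) : expr :=
  if i == input M then
    let body := And (Le midE z) (Lt z (Add midE (Mul (Cst 2) Size))) in
    match a with
    | None => Or (Lt z midE) (Le (Add midE word_lenE) z)
    | Some (inl true) => And body (word_bitE (Sub z midE))
    | Some (inl false) => Or (Eq z (Add midE (Mul (Cst 2) Size)))
        (And body (Not (word_bitE (Sub z midE))))
    | Some (inr _) => Bool false
    end
  else Bool (a == None).

Definition cert_cellE (t z : expr) : expr :=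
  And (Eq t (Cst 0)) (And (Lt (Add midE (Mul (Cst 2) Size)) z)
                          (Lt z (Add midE word_lenE))).

Definition accept_cellE (a : symbol) (z : expr) : expr :=
  Or (And (Eq z midE) (Bool (a != Some (inl true))))
     (And (Eq z (Add midE (Cst 1))) (Bool (is_bit a))).

Definition grid_guardE (k : constr) (q : expr) : expr :=
  let t := Div q widthE in let z := Mod q widthE in
  match k with
  | Distinct _ i j => Bool (i != j)
  | TwoValued l j => Bool ((1 < j) && ~~ is_const l)
  | Scan _ _ => Eq z midE
  | Next g g' => And (Eq z midE) (And (Lt t time_limE) (Bool (g'.1 == (action g).1)))
  | CarryDef _ _ _ => Bool true
  | Shift g i _ => And (Lt t time_limE) (And (Not (Eq z midE))
      (And (Lt (Cst 0) (Add z (Cst (shift_of g i))))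
           (Le (Add z (Cst (shift_of g i))) widthE)))
  | Write _ _ => And (Eq z midE) (Lt t time_limE)
  | StartState g => And (Eq t (Cst 0)) (And (Eq z midE) (Bool (g.1 == start M)))
  | StartCell i a => And (Eq t (Cst 0)) (start_cellE i a z)
  | GuessBit | GuessAny | GuessEnd => cert_cellE t z
  | Accept a => And (Eq t time_limE) (accept_cellE a z)
  end.

Definition grid_endsE (k : constr) (q : expr) :
    (location * expr) * seq (location * expr) :=
  let tt := (true_const, Cst 0) in let ff := (false_const, Cst 0) in
  match k with
  | Distinct l i j => ((l, q), [:: (Const i, Cst 0); (Const j, Cst 0)])
  | TwoValued l j => (tt, [:: (Const j, Cst 0); (l, q)])
  | Scan g j => ((Prefix g (lift ord0 j), q),
      [:: (Prefix g (widen_ord (leqnSn K) j), q);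
          (Cell (enum_val j) (g.2 (enum_val j)), q); ff])
  | Next g g' => ((Prefix g' ord0, Add q widthE), [:: (Prefix g ord_max, q); tt])
  | CarryDef g i a => ((Carry g i a, q),
      [:: (Prefix g ord_max, Add (Mul (Div q widthE) widthE) midE); (Cell i a, q); ff])
  | Shift g i a =>
      ((Cell i a, Sub (Add (Add q widthE) (Cst (shift_of g i))) (Cst 1)),
       [:: (Carry g i a, q); tt])
  | Write g i =>
      ((Cell i ((action g).2 i).1, Sub (Add (Add q widthE) (Cst (shift_of g i))) (Cst 1)),
       [:: (Prefix g ord_max, q); tt])
  | StartState g => (tt, [:: (Prefix g ord0, q); ff])
  | StartCell i a => (tt, [:: (Cell i a, q); ff])
  | GuessBit => ((Choice, q), [:: (Cell (input M) (Some (inl true)), q);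
                                  (Cell (input M) (Some (inl false)), q); tt])
  | GuessAny => (tt, [:: (Choice, q); (Cell (input M) None, q)])
  | GuessEnd => ((Cell (input M) None, Add q (Cst 1)), [:: (Cell (input M) None, q); tt])
  | Accept a => (ff, [:: (Cell (output M) a, q); tt])
  end.

Lemma istrue_start_cell w env i a z :
  istrue w env (start_cellE i a z) = start_cell w i a (eval w env z).
Proof.
rewrite /start_cellE /start_cell; case: ifP => _; last by rewrite istrueE.
case: a => [[[]|s]|]; rewrite /word_bitE /word_bit !istrueE;
  by rewrite ?(eval_mid, eval_word_len, evalE) ?andbA.
Qed.

Lemma istrue_grid_guard w env k q :
  istrue w env (grid_guardE k q) = guard (s := grid) w k (eval w env q).
Proof.
case: k => *; rewrite /grid_guardE /= /cert_cellE /cert_cell /accept_cellE /accept_cell;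
  rewrite !istrueE ?istrue_start_cell;
  rewrite ?(eval_mid, eval_width, eval_time_lim, eval_word_len, evalE) ?addn1 //.
Qed.

Lemma eval_grid_ends w env k q :
  ends (s := grid) w k (eval w env q) =
    (eval_loc (S := grid) w env (grid_endsE k q).1,
     [seq eval_loc (S := grid) w env b | b <- (grid_endsE k q).2]).
Proof.
by case: k => *; rewrite /= /eval_loc /= ?(eval_mid, eval_width, evalE).
Qed.

Lemma grid_area_gt0 w : 0 < grid_area w.
Proof. by rewrite /grid_area /width muln_gt0 !addn1. Qed.

Lemma grid_pos w t z : z < width w -> t <= time_lim w -> t * width w + z < grid_area w.
Proof. by rewrite /grid_area; nia. Qed.

(** A constraint reaches at most into the next row, and its guard then demands [t < time_lim]; the
    guards on the column keep the target within its row. *)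
Lemma grid_ends_lt w k q : q < grid_area w -> grid_guard w k q ->
  forall b, b \in (grid_ends w k q).1 :: (grid_ends w k q).2 -> b.2 < grid_area w.
Proof.
move=> hq; have w0 : 0 < width w by rewrite /width addn1.
have A0 := grid_area_gt0 w.
have tle : q %/ width w <= time_lim w.
  by rewrite -ltnS -[X in _ < X]addn1 ltn_divLR.
have zlt : q %% width w < width w by rewrite ltn_mod.
have hh : q %/ width w * width w + mid w < grid_area w.
  by apply: grid_pos => //; rewrite /width; lia.
have qE := divn_eq q (width w).
move: tle zlt qE hh; set t := q %/ _; set z := q %% _ => tle zlt qE hh.
have down : t < time_lim w -> q + width w < grid_area w.
  by move=> h; have := @grid_pos w t.+1 z zlt h; rewrite mulSn; lia.
have down2 s : t < time_lim w -> z + s <= width w -> q + width w + s - 1 < grid_area w.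
  move=> h h2; have [->|s0] := posnP s; first by have := down h; lia.
  have := @grid_pos w t.+1 (z + s - 1) _ h; rewrite mulSn => h3.
  by have := h3 ltac:(lia); lia.
have sh g i : shift_of g i <= 2 by rewrite /shift_of /shift; case: (_.2).
have all_lt (b0 : location * nat) s :
    b0.2 < grid_area w -> all (fun b => b.2 < grid_area w) s ->
    forall b, b \in b0 :: s -> b.2 < grid_area w.
  by move=> h /allP h2 b; rewrite inE => /orP[/eqP ->|/h2].
case: k => [l i j|l j|g j|g g'|g i a|g i a|g i|g|i a||||a]; rewrite /= -/t -/z => gd;
  apply: all_lt => //=; rewrite ?hq ?A0 ?hh //.
- by apply: down; case/and3P: gd.
- by apply: down2; case/and4P: gd.
- case/andP: gd => /eqP zm tl; apply: down2 => //.
  by have := sh g i; rewrite zm /width /mid; lia.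
- case/and3P: gd => /eqP t0 h1 h2.
  have := @grid_pos w t z.+1 _ tle => h3.
  by have := h3 ltac:(rewrite /width /mid; rewrite /mid in h2; lia); lia.
Qed.

Section Correctness.

Variables (V : pred bits) (w : bits).
Hypothesis MV : forall u : bits,
  exists2 t : nat, t <= poly_bound ct dt (size u) &
    let e := iter t (@step M) (init M u) in
    halted e.1 /\ bits_of_tape (e.2 (output M)) = [:: V u].

Lemma mid_gt0 : 0 < mid w.
Proof. by rewrite /mid addn1. Qed.

(** * From an accepted certificate to a colouring *)

Section Run.

Variable y : bits.

Definition config_at (t : nat) : config M := iter t (@step M) (init M (pair_bits w y)).

Definition content (i : tidx M) (t z : nat) : symbol :=
  cell_at (mid w) ((config_at t).2 i) z.

Definition local_at (t : nat) : local := local_of (config_at t).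

Lemma content_mid i t : content i t (mid w) = (local_at t).2 i.
Proof. by rewrite /content cell_at_head ffunE. Qed.

Lemma state_next t : (local_at t.+1).1 = (action (local_at t)).1.
Proof. by rewrite /local_at /config_at /= {1}/local_of [in LHS]stepE. Qed.

Lemma content_next i t z : 0 < z + shift_of (local_at t) i ->
  content i t.+1 (z + shift_of (local_at t) i - 1) =
  if z == mid w then ((action (local_at t)).2 i).1 else content i t z.
Proof.
move=> h; rewrite /content /config_at /= -/(config_at t) stepE /= ffunE.
by rewrite -cell_at_move // mid_gt0.
Qed.

Lemma content0 i z : content i 0 z =
  if (i == input M) && (mid w <= z) then
    nth None [seq Some (inl b) | b <- pair_bits w y] (z - mid w)
  else None.
Proof.
rewrite /content /= ffunE /cell_at /= nth_nil.
case: (ltnP z (mid w)) => h; first by rewrite andbF.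
rewrite andbT; case: eqP => _; last by rewrite /=; case: (z - _) => //= k; rewrite nth_nil.
by case: (z - _) => [|k] /=; rewrite ?nth0 ?nth_behead.
Qed.

Hypothesis ylen : size y <= cert_len w.

(** A halted configuration no longer changes, so the answer can be read at the common time
    [time_lim]. *)
Lemma accepting : V (pair_bits w y) <->
  content (output M) (time_lim w) (mid w) = Some (inl true) /\
  ~~ is_bit (content (output M) (time_lim w) (mid w).+1).
Proof.
have [t tle [hq e]] := MV (pair_bits w y).
have tl : t <= time_lim w.
  apply: (leq_trans tle); apply: leq_poly_bound.
  by rewrite size_pair_bits /word_len; lia.
have stable k : iter k (@step M) (config_at t) = config_at t.
  by elim: k => //= k ->; rewrite /step hq.
rewrite /content (_ : config_at (time_lim w) = config_at t); last first.
  by rewrite -(stable (time_lim w - t)) /config_at -iterD subnK.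
by rewrite -bits_of_tape_true e; split=> [->|[]].
Qed.

Lemma start_cell_content i a z : start_cell w i a z -> content i 0 z = a.
Proof.
rewrite /start_cell content0; case: eqP => /= _; last by move/eqP ->.
have sz : size (pair_bits w y) <= word_len w by rewrite size_pair_bits /word_len; lia.
have sz2 : 2 * size w < size (pair_bits w y) by rewrite size_pair_bits; lia.
case: a => [[[]|s]|] //.
- case/and3P => h1 h2 h3; rewrite h1 (nth_map false); last by lia.
  by rewrite nth_pair_bits (_ : _ < _) -?/(word_bit _ _) ?h3 //; lia.
- case/orP => [/eqP ->|/and3P[h1 h2 h3]].
    by rewrite leq_addr (nth_map false) ?addKn // nth_pair_bits ltnn eqxx.
  rewrite h1 (nth_map false); last by lia.
  rewrite nth_pair_bits (_ : _ < _) -?/(word_bit _ _) ?(negbTE h3) //; lia.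
- case: leqP => //= h1 h2; rewrite nth_default // size_map; lia.
Qed.

(** The intended truth values in the run on [pair_bits w y]. The value at [Const] is a placeholder,
    as [color] treats constants separately. *)
Definition truth (l : location) (t z : nat) : bool :=
  match l with
  | Const _ => true
  | Prefix g j => (g.1 == (local_at t).1) &&
      [forall i, (enum_rank i < j) ==> (g.2 i == (local_at t).2 i)]
  | Cell i a => content i t z == a
  | Carry g i a => (g == local_at t) && (content i t z == a)
  | Choice => is_bit (content (input M) t z)
  end.

Lemma truth_prefix_max g t z : truth (Prefix g ord_max) t z = (g == local_at t).
Proof.
rewrite /= -pair_eqE /pair_eq; congr andb.
apply/forallP/eqP => [h|-> i]; last by rewrite eqxx implybT.
by apply/ffunP => i; have := h i; rewrite ltn_ord => /eqP.
Qed.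

Lemma truth_prefix_next g (j : 'I_K) t z : truth (Prefix g (lift ord0 j)) t z =
  truth (Prefix g (widen_ord (leqnSn K) j)) t z &&
  (content (enum_val j) t (mid w) == g.2 (enum_val j)).
Proof.
rewrite /= -andbA content_mid; congr andb; apply/forallP/andP => [h|[/forallP h1 h2] i].
  split; last by have := h (enum_val j); rewrite enum_valK /bump /= ltnS leqnn eq_sym.
  apply/forallP => i; apply/implyP => hi; have := h i.
  by rewrite /bump /= add1n ltnS ltnW.
apply/implyP; rewrite /bump /= add1n ltnS leq_eqVlt => /orP[/eqP/ord_inj e|hi].
  by move: h2; rewrite -e enum_rankK eq_sym.
by have := h1 i; rewrite hi.
Qed.

(** True is colour 0 and false is colour 1, in agreement with [true_const] and [false_const]. *)
Definition color (b : location * nat) : nat :=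
  if b.1 is Const j then j
  else ~~ truth b.1 (b.2 %/ width w) (b.2 %% width w).

Local Arguments color : simpl never.
Local Arguments truth : simpl never.

Lemma color_pos l t z : ~~ is_const l -> z < width w ->
  color (l, t * width w + z) = ~~ truth l t z.
Proof.
move=> lc zw; have w0 : 0 < width w by rewrite /width addn1.
rewrite /color /= divnMDl // modnMDl divn_small // modn_small // addn0.
by case: l lc.
Qed.

(** A computable form of the condition on one constraint, which leaves only case distinctions on
    Booleans. *)
Definition allowed (v : nat) (s : seq nat) : bool :=
  pairwise (fun a b => (a == b) ==> (v == a)) s.

Lemma allowedP (f : location * nat -> nat) v s : allowed v (map f s) ->
  forall b1 b2, b1 \in s -> b2 \in s -> b1 != b2 -> f b1 = f b2 -> v = f b1.
Proof.
rewrite /allowed; elim: s => [|b s IH] //= /andP[/allP h1 h2] b1 b2.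
rewrite !inE => /orP[/eqP ->|m1] /orP[/eqP ->|m2].
- by rewrite eqxx.
- move=> _ e; have := h1 (f b2) (map_f f m2).
  by rewrite e eqxx => /eqP.
- move=> _ e; have := h1 (f b1) (map_f f m1).
  by rewrite e eqxx => /eqP.
- exact: IH.
Qed.

Lemma shift_le g i : shift_of g i <= 2.
Proof. by rewrite /shift_of /shift; case: (_.2). Qed.

Lemma coloring_complete : V (pair_bits w y) ->
  forall (k : constr) q, q < grid_area w -> grid_guard w k q ->
  forall b1 b2, b1 \in (grid_ends w k q).2 -> b2 \in (grid_ends w k q).2 ->
    b1 != b2 -> color b1 = color b2 -> color (grid_ends w k q).1 = color b1.
Proof.
move=> acc k q hq gd; apply: allowedP; move: gd.
have w0 : 0 < width w by rewrite /width addn1.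
have midw : mid w < width w by rewrite /width; lia.
have zlt : q %% width w < width w by rewrite ltn_mod.
rewrite /grid_guard; have := divn_eq q (width w).
move: zlt; set t := q %/ _; set z := q %% _ => zlt qE.
have cq l : ~~ is_const l -> color (l, q) = ~~ truth l t z.
  by move=> lc; rewrite qE color_pos.
have cdown l s : ~~ is_const l -> 0 < z + s -> z + s <= width w ->
    color (l, q + width w + s - 1) = ~~ truth l t.+1 (z + s - 1).
  move=> lc h1 h2.
  have -> : q + width w + s - 1 = t.+1 * width w + (z + s - 1) by rewrite mulSn; lia.
  by rewrite color_pos //; lia.
have tt0 : color (true_const, 0) = 0 by [].
have ff0 : color (false_const, 0) = 1 by [].
(* The recurring shapes: a conjunction of premises, an implication, a fact. *)
have sat3 (v : nat) (a b : bool) (c : nat) :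
    v = ~~ (a && b) -> c = 1 -> allowed v [:: ~~ a : nat; ~~ b : nat; c].
  by move=> -> ->; case: a; case: b.
have sat2 (v : nat) (a : bool) : (a ==> (v == 0)) -> allowed v [:: ~~ a : nat; 0].
  by case: a => //= /eqP ->.
have fact (a : bool) : a -> allowed 0 [:: ~~ a : nat; 1] by move->.
case: k => [l i j|l j|g j|g g'|g i a|g i a|g i|g|i a||||a];
  rewrite /grid_ends ![map _ _]/= ?[(_, _).1]/= ?tt0 ?ff0 => gd.
- rewrite /allowed /= !andbT; apply/implyP => /eqP/val_inj e.
  by rewrite e eqxx in gd.
- case/andP: gd => j1 lc; rewrite (cq _ lc) /allowed /= !andbT.
  by rewrite {1}/color /=; case: (truth _ _ _) => /=; case: (j : nat) j1 => [|[|]].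
- rewrite !cq // truth_prefix_next; apply: sat3 => //.
  by rewrite /truth -/truth (eqP gd).
- case/and3P: gd => /eqP zm tl /eqP eg; rewrite cq //; apply: sat2; apply/implyP.
  rewrite truth_prefix_max => /eqP e.
  have -> : q + width w = q + width w + 1 - 1 by lia.
  rewrite cdown //; [|by rewrite addn1|by lia].
  rewrite /truth eg e -state_next eqxx /=.
  by case: forallP => // -[] i; apply/implyP.
- rewrite -/t color_pos // truth_prefix_max !cq //; apply: sat3 => //.
- case/and4P: gd => tl zm h1 h2; rewrite cq //; apply: sat2.
  apply/implyP => /andP[/eqP eg /eqP <-].
  rewrite cdown // /truth; rewrite eg in h1 *; rewrite content_next // (negbTE zm).
  by rewrite eqxx.
- case/andP: gd => /eqP zm tl; rewrite cq //; apply: sat2; rewrite truth_prefix_max.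
  apply/implyP => /eqP eg; have sh := shift_le g i; have m0 := mid_gt0.
  rewrite cdown //; [|by lia|by rewrite zm /width; lia].
  rewrite /truth eg content_next; last by lia.
  by rewrite zm eqxx eqxx.
- case/and3P: gd => /eqP t0 _ /eqP eg; rewrite cq //; apply: fact.
  rewrite /truth eg t0 eqxx /=.
  by apply/forallP.
- case/andP: gd => /eqP t0 sc; rewrite cq //; apply: fact.
  by rewrite /truth t0 (start_cell_content sc).
- rewrite !cq // /truth; case: (content _ _ _) => [[[]|?]|] //.
- rewrite !cq // /truth; case/and3P: gd => /eqP -> h1 h2.
  rewrite content0 eqxx (ltnW (leq_ltn_trans (leq_addr _ _) h1)) /=.
  case: (ltnP (z - mid w) (size (pair_bits w y))) => h.
    by rewrite (nth_map false).
  by rewrite nth_default ?size_map.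
- case/and3P: gd => /eqP t0 h1 h2; rewrite cq //; apply: sat2; apply/implyP.
  have -> : q + 1 = t * width w + z.+1 by lia.
  rewrite color_pos //; last by rewrite /width /mid; rewrite /mid in h2; lia.
  rewrite /truth t0 !content0 eqxx /=.
  have hz : mid w <= z by lia.
  rewrite hz (leqW hz) subSn // => /eqP h.
  rewrite eqb0 negbK; apply/eqP.
  case: (ltnP (z - mid w) (size (pair_bits w y))) => h3.
    by move: h; rewrite (nth_map false).
  by rewrite nth_default // size_map leqW.
(* Acceptance enters only here: the run ends with none of the forbidden symbols. *)
- case/andP: gd => /eqP t1 ac; rewrite cq // /truth t1.
  suff -> : (content (output M) (time_lim w) z == a) = false by [].
  have [a1 a2] := accepting.1 acc.
  apply/eqP => e; case/orP: ac => /andP[/eqP zE]; rewrite -e zE.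
    by rewrite a1.
  by rewrite (negbTE a2).
Qed.

(** Outside the certificate the facts of [start_cell] determine the whole first row. *)
Lemma content_start_cell i z :
  ~~ ((i == input M) && cert_cell w 0 z) -> start_cell w i (content i 0 z) z.
Proof.
rewrite /start_cell /cert_cell content0 eqxx /=; case: eqP => //= _.
have sz := size_pair_bits w y; have wl := ylen; rewrite negb_and -!leqNgt => h.
case: (leqP (mid w) z) => //= hz.
case: (ltngtP (z - mid w) (2 * size w)) => h1.
- rewrite (nth_map false); last by lia.
  rewrite nth_pair_bits h1 -/(word_bit _ _).
  case e: (word_bit _ _); rewrite andbT; first by lia.
  by apply/orP; right; lia.
- have h3 : mid w + word_len w <= z by lia.
  rewrite nth_default ?h3 ?orbT // size_map; rewrite /word_len in h3; lia.
- rewrite h1 (nth_map false); last by lia.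
  by rewrite nth_pair_bits ltnn eqxx; apply/orP; left; lia.
Qed.

End Run.

(** * From a colouring to an accepted certificate *)

Section Sound.

Variable C : location * nat -> nat.
Hypothesis C_lt : forall b, b.2 < grid_area w -> C b < p.
Hypothesis C_onto : forall j, j < p -> exists2 b, b.2 < grid_area w & C b = j.
Hypothesis C_sat : forall (k : constr) q, q < grid_area w -> grid_guard w k q ->
  forall b1 b2, b1 \in (grid_ends w k q).2 -> b2 \in (grid_ends w k q).2 ->
    b1 != b2 -> C b1 = C b2 -> C (grid_ends w k q).1 = C b1.

Notation T := (C (true_const, 0)).
Notation F := (C (false_const, 0)).

(** If two constants shared a colour, the [Distinct] constraints would force this colour on every
    block, although at least two colours occur. *)
Lemma const_inj i j : C (Const i, 0) = C (Const j, 0) -> i = j.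
Proof.
move=> e; apply/eqP/negPn/negP => ij.
have all_eq b : b.2 < grid_area w -> C b = C (Const i, 0).
  case: b => l q /= hq; apply: (C_sat (k := Distinct l i j) hq ij _ _ _ e).
  - by rewrite inE eqxx.
  - by rewrite !inE eqxx orbT.
  - by apply: contra ij => /eqP[->].
have [b0 h0 e0] := C_onto (ltn0Sn _); have [b1 h1 e1] := C_onto (isT : 1 < p).
by move: e1; rewrite all_eq // -(all_eq _ h0) e0.
Qed.

Lemma true_neq_false : T <> F.
Proof. by move/const_inj. Qed.

(** The [p] constants have distinct colours, hence all colours; so the block agrees with some
    [Const j], and [TwoValued] rules out [1 < j] unless the colour is that of true. *)
Lemma two_valued l q : ~~ is_const l -> q < grid_area w ->
  C (l, q) = T \/ C (l, q) = F.
Proof.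
move=> lc hq.
pose f (j : 'I_p) : 'I_p := Ordinal (C_lt (grid_area_gt0 w : (Const j, 0).2 < _)).
have [g _ gK] : bijective f.
  by apply: injF_bij => i j /(congr1 val) /= /const_inj.
have := gK (Ordinal (C_lt (hq : (l, q).2 < _))); set j := g _ => /(congr1 val) /= <-.
have [j1|] := ltnP 1 j.
  case: (eqVneq (C (Const j, 0)) T) => [->|h]; first by left.
  have cj : C (Const j, 0) = C (l, q).
    by have := gK (Ordinal (C_lt (hq : (l, q).2 < _))) => /(congr1 val) /=.
  have gd : grid_guard w (TwoValued l j) q by rewrite /= j1 lc.
  have := C_sat hq gd _ _ _ cj; rewrite !inE !eqxx orbT => /(_ isT isT).
  have -> : (Const j, 0) != (l, q) by apply/eqP => -[e _]; rewrite -e in lc.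
  by move=> /(_ isT) e; rewrite -e eqxx in h.
case: j => -[|[|j]] hj //= _; [left|right]; congr (C (Const _, 0)); exact: val_inj.
Qed.

Lemma not_true l q : ~~ is_const l -> q < grid_area w -> C (l, q) <> T -> C (l, q) = F.
Proof. by move=> lc hq; case: (two_valued lc hq). Qed.

Section Rules.

Variables (k : constr) (q : nat).
Hypotheses (hq : q < grid_area w) (gd : grid_guard w k q).

Lemma not_const_neq (a : location * nat) j n : ~~ is_const a.1 -> a != (Const j, n).
Proof. by move=> h; apply/eqP => e; rewrite e in h. Qed.

Lemma imp_rule c a : grid_ends w k q = (c, [:: a; (true_const, 0)]) ->
  ~~ is_const a.1 -> C a = T -> C c = T.
Proof.
move=> e ac aT; have := C_sat hq gd; rewrite e /= => /(_ a (true_const, 0)).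
by rewrite !inE !eqxx orbT not_const_neq // -aT; apply.
Qed.

Lemma and_rule c a b : grid_ends w k q = (c, [:: a; b; (false_const, 0)]) ->
  a != b -> C a = T -> C b = T -> C c = T.
Proof.
move=> e ab aT bT; have := C_sat hq gd; rewrite e /= => /(_ a b).
by rewrite !inE !eqxx orbT ab aT bT; apply.
Qed.

Lemma fact_rule a : grid_ends w k q = ((true_const, 0), [:: a; (false_const, 0)]) ->
  ~~ is_const a.1 -> a.2 < grid_area w -> C a = T.
Proof.
case: a => l r /= e ac hr; case: (two_valued ac hr) => // aF.
have := C_sat hq gd; rewrite e /= => /(_ (l, r) (false_const, 0)).
by rewrite !inE !eqxx orbT not_const_neq // aF => ->.
Qed.

Lemma absurd_rule a : grid_ends w k q = ((false_const, 0), [:: a; (true_const, 0)]) ->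
  ~~ is_const a.1 -> C a <> T.
Proof.
move=> e ac aT; have := C_sat hq gd; rewrite e /= => /(_ a (true_const, 0)).
rewrite !inE !eqxx orbT not_const_neq // -aT => /(_ isT isT isT erefl) h.
by apply: true_neq_false; rewrite h aT.
Qed.

Lemma or_rule l1 r1 l2 r2 :
  grid_ends w k q = ((true_const, 0), [:: (l1, r1); (l2, r2)]) ->
  ~~ is_const l1 -> ~~ is_const l2 -> r1 < grid_area w -> r2 < grid_area w ->
  (l1, r1) != (l2, r2) -> C (l1, r1) = T \/ C (l2, r2) = T.
Proof.
move=> e c1 c2 h1 h2 ne.
case: (two_valued c1 h1) => [|e1]; first by left.
case: (two_valued c2 h2) => [|e2]; first by right.
have := C_sat hq gd; rewrite e /= => /(_ _ _ _ _ ne).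
rewrite !inE !eqxx orbT e1 e2 => /(_ isT isT erefl) h.
by case: true_neq_false.
Qed.

(** If [a] and [b] were both false they would share a colour, and the centre would be false as
    well. *)
Lemma choice_rule c a b : grid_ends w k q = (c, [:: a; b; (true_const, 0)]) ->
  ~~ is_const a.1 -> ~~ is_const b.1 -> a.2 < grid_area w -> b.2 < grid_area w ->
  a != b -> C c = T -> C a <> T -> C b = T.
Proof.
case: a b => la ra [lb rb] /= e ac bc ha hb ab cT aT.
case: (two_valued bc hb) => // bF; have aF := not_true ac ha aT.
have := C_sat hq gd; rewrite e /= => /(_ _ _ _ _ ab).
rewrite !inE !eqxx orbT aF bF cT => /(_ isT isT erefl) h.
by case: true_neq_false.
Qed.

End Rules.

Definition cert_pos (j : nat) : nat := mid w + 2 * size w + 1 + j.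

(** The certificate is read off the colouring up to the first cell whose blank variable is true, or
    up to [cert_len] if there is none. *)
Definition cert_size : nat :=
  find (fun j => C (Cell (input M) None, cert_pos j) == T) (iota 0 (cert_len w)).

Definition cert : bits :=
  mkseq (fun j => C (Cell (input M) (Some (inl true)), cert_pos j) == T) cert_size.

Lemma cert_size_le : cert_size <= cert_len w.
Proof. by rewrite /cert_size -{2}(size_iota 0 (cert_len w)) find_size. Qed.

Lemma size_cert : size cert <= cert_len w.
Proof. by rewrite size_mkseq cert_size_le. Qed.

Lemma width_gt0 : 0 < width w.
Proof. by rewrite /width addn1. Qed.

Lemma pos_div t z : z < width w -> (t * width w + z) %/ width w = t.
Proof. by move=> h; rewrite divnMDl ?width_gt0 // divn_small // addn0. Qed.

Lemma pos_mod t z : z < width w -> (t * width w + z) %% width w = z.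
Proof. by move=> h; rewrite modnMDl modn_small. Qed.

Lemma row0_lt z : z < width w -> z < grid_area w.
Proof. by move=> h; have := grid_pos h (leq0n (time_lim w)). Qed.

Lemma start_cell_true i a z : z < width w -> start_cell w i a z ->
  C (Cell i a, z) = T.
Proof.
move=> hz sc; apply: (fact_rule (k := StartCell i a) (row0_lt hz)) => //; last exact: row0_lt.
by rewrite /= divn_small // modn_small.
Qed.

Lemma cert_posP j : j < cert_len w ->
  cert_pos j < width w /\ cert_cell w (cert_pos j %/ width w) (cert_pos j %% width w).
Proof.
move=> h; have h2 : cert_pos j < width w by rewrite /cert_pos /width /mid /word_len; lia.
by split=> //; rewrite /cert_cell divn_small // modn_small // /cert_pos /word_len; lia.
Qed.

(** From the first blank on, [GuessEnd] propagates blanks to the right; beyond the certificate area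
    they are facts of the first row. *)
Lemma cert_blank j : cert_size <= j -> cert_pos j < width w ->
  C (Cell (input M) None, cert_pos j) = T.
Proof.
have late i : cert_len w <= i -> cert_pos i < width w ->
    C (Cell (input M) None, cert_pos i) = T.
  move=> h1 h2; apply: start_cell_true => //.
  by rewrite /start_cell eqxx /cert_pos /word_len; lia.
have first_blank : cert_size < cert_len w ->
    C (Cell (input M) None, cert_pos cert_size) = T.
  move=> h; have hh : cert_size < size (iota 0 (cert_len w)) by rewrite size_iota.
  move: hh; rewrite -has_find => /(nth_find 0).
  by rewrite -/cert_size nth_iota // => /eqP.
elim: j => [|j IH] hj hp.
  have [h|h] := leqP (cert_len w) 0; first exact: late.
  have e : cert_size = 0 by lia.
  by have := first_blank; rewrite e; apply.
have [h|h] := leqP (cert_len w) j.+1; first exact: late.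
move: hj; rewrite leq_eqVlt => /orP[/eqP e|hj].
  by rewrite -e in h *; apply: first_blank.
have [hp' cc] := cert_posP (ltnW h).
have -> : cert_pos j.+1 = cert_pos j + 1 by rewrite /cert_pos; lia.
apply: (imp_rule (k := GuessEnd) (row0_lt hp')) => //.
exact: IH.
Qed.

(** Here and below only the true statements about the run on [cert] are derived. A colouring may
    make further variables true; the final contradiction with [Accept] concerns a true statement. *)
Lemma start_row_true i z : z < width w ->
  C (Cell i (content cert i 0 z), z) = T.
Proof.
move=> hz.
have [|h] := boolP ((i == input M) && cert_cell w 0 z); last first.
  by apply: start_cell_true => //; apply: content_start_cell => //; exact: size_cert.
case/andP => /eqP -> /and3P[_ h1 h2].
have zE : z = cert_pos (z - (mid w + 2 * size w + 1)) by rewrite /cert_pos; lia.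
move: zE; set j := z - _ => zE.
have jlt : j < cert_len w by rewrite /j; rewrite /word_len in h2; lia.
rewrite content0 eqxx (leq_trans (leq_addr _ _) (ltnW h1)) /=.
have zm : z - mid w = (2 * size w).+1 + j by rewrite zE /cert_pos; lia.
have [hj|hj] := leqP cert_size j.
  rewrite nth_default; first by rewrite zE; apply: cert_blank; rewrite -?zE.
  by rewrite size_map size_pair_bits size_mkseq zm; lia.
rewrite (nth_map false); last by rewrite size_pair_bits size_mkseq zm; lia.
rewrite nth_pair_bits ifF; last by rewrite zm; lia.
rewrite ifF; last by rewrite zm; lia.
rewrite zm addKn nth_mkseq // -zE.
have [hp cc] := cert_posP jlt; rewrite -zE in hp cc.
have qlt := row0_lt hz.
(* Before the first blank, [GuessAny] leaves only [Choice], so one of the two bits is present. If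
   [true] is, the certificate has this bit by definition; otherwise [GuessBit] yields [false]. *)
have notblank : C (Cell (input M) None, z) <> T.
  have := before_find 0 (hj : j < find _ _); rewrite nth_iota // add0n -zE.
  by move/eqP.
have ch : C (Choice, z) = T.
  by case: (or_rule (k := GuessAny) qlt cc (erefl _)).
case: eqP => // aT.
apply: (choice_rule (k := GuessBit) qlt cc (erefl _) _ _ _ _ _ ch aT) => //.
by apply/eqP => -[].
Qed.

Notation y := cert.

(** Each use of [Scan] confirms the symbol under one more head. *)
Lemma prefix_true t g (j : 'I_K.+1) : t <= time_lim w ->
    (forall i, C (Cell i (content y i t (mid w)), t * width w + mid w) = T) ->
    g = local_at y t -> C (Prefix g ord0, t * width w + mid w) = T ->
  C (Prefix g j, t * width w + mid w) = T.
Proof.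
move=> tle cT ge g0; have midw : mid w < width w by rewrite /width; lia.
have qlt := grid_pos midw tle.
case: j => j; elim: j => [|j IH] hj.
  by rewrite -[RHS]g0; congr (C (Prefix _ _, _)); apply: val_inj.
have jK : j < K by [].
pose jj := Ordinal jK.
have -> : Ordinal hj = lift ord0 jj by apply: val_inj.
apply: (and_rule (k := Scan g jj) qlt _ (erefl _)) => //.
- by rewrite /= pos_mod.
- rewrite -[RHS](IH (ltnW hj)); congr (C (Prefix _ _, _)); exact: val_inj.
- by rewrite -[RHS](cT (enum_val jj)) content_mid ge.
Qed.

(** Induction on the time. A cell moves by at most one column per step, so the range of columns is
    narrowed by one on either side to have every source in the previous range. *)
Lemma run_true t : t <= time_lim w ->
  (forall i z, t <= z -> z + t <= 2 * mid w ->
     C (Cell i (content y i t z), t * width w + z) = T) /\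
  (forall g : local, g.1 = (local_at y t).1 ->
     C (Prefix g ord0, t * width w + mid w) = T).
Proof.
have midw : mid w < width w by rewrite /width; lia.
have tmid : time_lim w < mid w by rewrite /mid; lia.
elim: t => [|t IH] tle.
  split=> [i z _ hz|g ge].
    by rewrite mul0n; apply: start_row_true; rewrite /width; lia.
  rewrite mul0n; apply: (fact_rule (k := StartState g) (row0_lt midw)) => //.
    by rewrite /= divn_small // modn_small // ge !eqxx.
  exact: row0_lt.
have [cT sT] := IH (ltnW tle).
set g := local_at y t.
have qlt := grid_pos midw (ltnW tle).
have gT : C (Prefix g ord_max, t * width w + mid w) = T.
  apply: prefix_true => //; first exact: ltnW.
    by move=> i; apply: cT; lia.
  exact: sT.
have below : t.+1 * width w + mid w = t * width w + mid w + width w by rewrite mulSn; lia.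
split=> [i z h1 h2|g' ge]; last first.
  rewrite below; apply: (imp_rule (k := Next g g') qlt _ (erefl _)) => //.
  by rewrite /= pos_div // pos_mod // eqxx tle ge state_next eqxx.
have sh := shift_le g i.
(* [z'] is the column of row [t] whose cell moves to column [z]; as [z] is positive, the subtraction
   does not truncate. *)
have sE : z = z + 1 - shift_of g i + shift_of g i - 1 by lia.
move: sE; set z' := z + 1 - _ => sE.
have hz' : t <= z' /\ z' + t <= 2 * mid w by rewrite /z'; lia.
have zw' : z' < width w by rewrite /width; lia.
have s0 : 0 < z' + shift_of g i by lia.
have qE : t.+1 * width w + z = t * width w + z' + width w + shift_of g i - 1.
  by rewrite mulSn; lia.
have qlt' := grid_pos zw' (ltnW tle).
rewrite qE {1}sE content_next //; case: (eqVneq z' (mid w)) => zm.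
  rewrite zm; apply: (imp_rule (k := Write g i) qlt _ (erefl _)) => //.
  by rewrite /= pos_mod // pos_div // eqxx.
apply: (imp_rule (k := Shift g i _) qlt' _ (erefl _)) => //.
  by rewrite /= pos_div // pos_mod // zm tle /=; rewrite /width; lia.
apply: (and_rule (k := CarryDef g i _) qlt' isT) => /=; rewrite ?pos_div //.
by apply: cT; lia.
Qed.

(** In the last row the variable of the actual symbol is true, so a rejecting symbol at [mid] or
    [mid.+1] would violate [Accept]. *)
Lemma cert_accepted : V (pair_bits w cert).
Proof.
have tmid : time_lim w < mid w by rewrite /mid; lia.
have midw : mid w < width w by rewrite /width; lia.
have midw1 : (mid w).+1 < width w by rewrite /width; lia.
have [cT _] := run_true (leqnn (time_lim w)).
have no_accept a z : z < width w -> accept_cell w a z ->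
    C (Cell (output M) a, time_lim w * width w + z) <> T.
  move=> hz ac; apply: (absurd_rule (k := Accept a) (grid_pos hz (leqnn _)) _ (erefl _)) => //.
  by rewrite /= pos_div // pos_mod // eqxx.
apply/(accepting size_cert); split.
  apply/eqP/negPn/negP => h.
  apply: (no_accept (content y (output M) (time_lim w) (mid w)) (mid w) midw);
    last by apply: cT; lia.
  by rewrite /accept_cell eqxx h.
apply/negP => h.
apply: (no_accept (content y (output M) (time_lim w) (mid w).+1) (mid w).+1 midw1);
  last by apply: cT; lia.
by rewrite /accept_cell eqxx h orbT.
Qed.

End Sound.

Theorem tableau_partition : has_P3_convex_partition p (system_graph grid p w) <->
  exists2 y, size y <= cert_len w & V (pair_bits w y).
Proof.
rewrite system_partition //; [|exact: grid_area_gt0|exact: grid_ends_lt].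
split=> [[C [C_lt C_onto C_sat]]|[y ylen acc]].
  exists (cert C); first exact: size_cert.
  exact: cert_accepted C_lt C_onto C_sat.
exists (color y); split=> [[[j|g j|i a|g i a|] q] hq|j hj|].
- exact: ltn_ord.
- by rewrite /color; case: (truth _ _ _ _).
- by rewrite /color; case: (truth _ _ _ _).
- by rewrite /color; case: (truth _ _ _ _).
- by rewrite /color; case: (truth _ _ _ _).
- by exists (Const (Ordinal hj), 0) => //=; exact: grid_area_gt0.
- exact: coloring_complete.
Qed.

End Correctness.

Lemma poly_time_tableau :
  poly_time (fun w => encode_graph (system_graph grid p w)).
Proof.
apply: (@poly_time_system grid p grid_areaE grid_guardE grid_endsE).
- by move=> w env; rewrite eval_grid_area.
- by move=> w env c P; rewrite istrue_grid_guard.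
- by move=> w env c P; rewrite eval_grid_ends.
Qed.

End Tableau.

(** * Verification of a colouring *)

Lemma AllP w env x a b :
  reflect (forall i, i < eval w env a -> istrue w (upd env x i) b)
          (istrue w env (All x a b)).
Proof.
rewrite istrue_All; apply: (iffP forallP) => [h i hi|h i]; last exact: h.
exact: (h (Ordinal hi)).
Qed.

Lemma ExP w env x a b :
  reflect (exists2 i, i < eval w env a & istrue w (upd env x i) b)
          (istrue w env (Ex x a b)).
Proof.
rewrite istrue_Ex; apply: (iffP existsP) => [[i h]|[i hi h]]; first by exists i.
by exists (Ordinal hi).
Qed.

Lemma nth_allpairs (S R T : Type) (h : S -> R -> T) s t x0 s0 t0 i j :
  i < size s -> j < size t ->
  nth x0 [seq h a b | a <- s, b <- t] (i * size t + j) = h (nth s0 s i) (nth t0 t j).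
Proof.
move=> + jt; elim: s i => [|a s IH] [|i] //= hi; rewrite nth_cat size_map.
  by rewrite mul0n jt (nth_map t0).
by rewrite mulSn -addnA ltnNge leq_addr /= addKn IH.
Qed.

Section EncodeGraph.

Variable G : sgraph.
Notation n := (order G).

Lemma size_encode_graph : size (encode_graph G) = n + 1 + n * n.
Proof. by rewrite /encode_graph size_cat size_nseq /= size_allpairs size_enum_ord; lia. Qed.

Lemma nth_encode_order i : nth false (encode_graph G) i = true -> i <> n.
Proof. by move=> h e; move: h; rewrite e nth_cat size_nseq ltnn subnn. Qed.

Lemma nth_encode_lt i : i < n -> nth false (encode_graph G) i.
Proof. by move=> h; rewrite nth_cat size_nseq h nth_nseq h. Qed.

Lemma nth_encode_adj (u v : vertex G) :
  nth false (encode_graph G) (n + 1 + (u * n + v)) = adj u v.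
Proof.
rewrite nth_cat size_nseq ltnNge -addnA leq_addr /= addKn /=.
have := @nth_allpairs _ _ _ (fun u v : vertex G => adj u v) (enum 'I_n) (enum 'I_n)
  false u v u v.
by rewrite size_enum_ord !nth_ord_enum => ->.
Qed.

End EncodeGraph.

Section Verifier.

Variables (p' : nat) (bip : bool).
Notation p := p'.+2.

(** In a pair, bit [i] of [x] stands at position [2 * i + 1], and [y] starts right after the
    separator at [2 * size x]. The variable 9 in [colorE] lies above all variables bound around
    it. *)
Let X (i : expr) : expr := Bitat (Add (Mul (Cst 2) i) (Cst 1)).
Let Y (j : expr) : expr := Bitat (Add (Add (Mul (Cst 2) (Var 0)) (Cst 1)) j).
Let adjE (u v : expr) : expr :=
  X (Add (Add (Var 1) (Cst 1)) (Add (Mul u (Var 1)) v)).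
Let colorE (u : expr) : expr :=
  Sum 9 (Cst p'.+1) (Y (Add (Mul u (Cst p)) (Var 9))).
Let sideE (u : expr) : expr := Y (Add (Mul u (Cst p)) (Cst p'.+1)).

Let headerE := And (All 2 (Var 1) (X (Var 2))) (And (Not (X (Var 1)))
  (Eq (Var 0) (Add (Add (Var 1) (Cst 1)) (Mul (Var 1) (Var 1))))).
Let symE := All 2 (Var 1) (All 3 (Var 1)
  (Or (Not (adjE (Var 2) (Var 3))) (adjE (Var 3) (Var 2)))).
Let irrE := All 2 (Var 1) (Not (adjE (Var 2) (Var 2))).
Let ontoE := All 2 (Cst p) (Ex 3 (Var 1) (Eq (colorE (Var 3)) (Var 2))).
Let convexE := All 2 (Var 1) (All 3 (Var 1) (All 4 (Var 1)
  (Or (Or (Eq (Var 2) (Var 4)) (Or (Not (adjE (Var 2) (Var 3))) (Not (adjE (Var 3) (Var 4)))))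
      (Or (Not (Eq (colorE (Var 2)) (colorE (Var 4))))
          (Eq (colorE (Var 3)) (colorE (Var 2))))))).
Let bipE := All 2 (Var 1) (All 3 (Var 1)
  (Or (Not (adjE (Var 2) (Var 3))) (Not (Eq (sideE (Var 2)) (sideE (Var 3)))))).

(* On [pair_bits x y], the variable [0] is the length of [x] and the variable [1] the
   number of vertices.  In [y], the vertex [u] has a block of [p] bits: its
   colour is the number of ones among the first [p - 1] of them, and the last
   one is its side in a bipartition. *)
Definition verifierE : expr :=
  Ex 0 Size (And (All 2 (Var 0) (Bitat (Mul (Cst 2) (Var 2))))
    (And (Not (Bitat (Mul (Cst 2) (Var 0))))
    (Ex 1 (Var 0) (And headerE (And symE (And irrE (And ontoE (And convexE
       (if bip then bipE else Bool true))))))))).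

Definition verifier (w : bits) : bool := istrue w (fun=> 0) verifierE.

Lemma poly_time_verifier : poly_time_pred verifier.
Proof. exact: (poly_time_gen (Emit verifierE)). Qed.

Definition color_of (y : bits) (u : nat) : nat :=
  \sum_(k < p'.+1) nth false y (u * p + k).

Definition side_of (y : bits) (u : nat) : bool := nth false y (u * p + p'.+1).

Definition adj_of (x : bits) (n u v : nat) : bool := nth false x (n + 1 + (u * n + v)).

Definition valid (x y : bits) (n : nat) : Prop :=
  [/\ [/\ forall i, i < n -> nth false x i, ~~ nth false x n & size x = n + 1 + n * n],
      (forall u v, u < n -> v < n -> adj_of x n u v -> adj_of x n v u) /\
      (forall u, u < n -> ~~ adj_of x n u u),
      forall k, k < p -> exists2 u, u < n & color_of y u = k,
      forall u v z, u < n -> v < n -> z < n -> u <> z -> adj_of x n u v ->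
        adj_of x n v z -> color_of y u = color_of y z -> color_of y v = color_of y u &
      bip -> forall u v, u < n -> v < n -> adj_of x n u v -> side_of y u != side_of y v].

Section Fixed.

Variables x y : bits.
Notation w := (pair_bits x y).

Lemma eval_X env i : eval w env i < size x ->
  istrue w env (X i) = nth false x (eval w env i).
Proof.
move=> h; rewrite /X !istrueE !evalE nth_pair_bits ifT; last by lia.
rewrite mulnC modnMDl divnMDl // !(@divn_small 1) // addn0.
by [].
Qed.

Lemma eval_Y env j : env 0 = size x ->
  eval w env (Y j) = nth false y (eval w env j).
Proof.
move=> h; rewrite /Y !evalE h nth_pair_bits ifF; last by lia.
rewrite ifF; last by lia.
by congr (nat_of_bool (nth _ _ _)); lia.
Qed.

Lemma eval_color env u : fresh u <= 9 -> env 0 = size x ->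
  eval w env (colorE u) = color_of y (eval w env u).
Proof.
move=> fu h; rewrite /colorE /color_of eval_Sum; apply: eq_bigr => i _.
by rewrite eval_Y // !evalE eval_upd_fresh.
Qed.

Lemma eval_side env u : env 0 = size x ->
  eval w env (sideE u) = side_of y (eval w env u).
Proof. by move=> h; rewrite /sideE eval_Y // !evalE. Qed.

Lemma eval_adj env n u v : env 1 = n -> size x = n + 1 + n * n ->
  eval w env u < n -> eval w env v < n ->
  istrue w env (adjE u v) = adj_of x n (eval w env u) (eval w env v).
Proof.
move=> hn sx hu hv; rewrite /adjE eval_X !evalE hn // sx.
by nia.
Qed.

Lemma verifierP : reflect (exists n, valid x y n) (verifier w).
Proof.
have sw := size_pair_bits x y.
apply: (iffP idP).
- case/ExP => m; rewrite evalE => mw; rewrite !istrue_And => /and3P[/AllP h1 h2].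
  (* The length is unique: a shorter one would find a mark at its separator, a longer one the
     separator among its marks. *)
  have em : m = size x.
    apply/eqP; case: (ltngtP m (size x)) => // hm.
    + move: h2; rewrite !istrueE !evalE /upd /= nth_pair_bits ifT; last by lia.
      by rewrite modnMr.
    + have := h1 (size x) hm; rewrite !istrueE !evalE /upd /= nth_pair_bits.
      by rewrite ltnn eqxx.
  rewrite {}em {h1 h2 m mw}.
  case/ExP => n; rewrite evalE /upd /= => nx.
  set env := fun _ => _; rewrite !istrue_And.
  case/and4P => /and3P[/AllP h1 h2 h3] h4 h5 /and3P[h6 h7 h8].
  have sx : size x = n + 1 + n * n by move: h3; rewrite istrue_Eq !evalE => /eqP.
  exists n; split.
  + split=> // [i hi|].
      by have := h1 i hi; rewrite eval_X !evalE /upd /=; lia.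
    by move: h2; rewrite istrue_Not eval_X.
  + split=> [u v hu hv|u hu].
      move/AllP/(_ u hu)/AllP/(_ v hv): h4.
      by rewrite istrue_Or istrue_Not !(@eval_adj _ n) // => /orP[/negP|].
    move/AllP/(_ u hu): h5.
    by rewrite istrue_Not (@eval_adj _ n).
  + move=> k hk; move/AllP/(_ k hk)/ExP: h6 => [u hu].
    by rewrite istrue_Eq eval_color // => /eqP e; exists u.
  + move=> u v z hu hv hz uz auv avz cuz.
    move/AllP/(_ u hu)/AllP/(_ v hv)/AllP/(_ z hz): h7.
    rewrite !(istrue_Or, istrue_Not, istrue_Eq) !(@eval_adj _ n) //.
    rewrite !eval_color // !evalE /upd /=.
    by move/eqP/negbTE: uz => ->; rewrite auv avz cuz eqxx /= => /eqP.
  + move=> hb u v hu hv auv; move: h8; rewrite hb => /AllP/(_ u hu)/AllP/(_ v hv).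
    rewrite istrue_Or !istrue_Not istrue_Eq (@eval_adj _ n) // !eval_side //.
    rewrite !evalE /upd /= auv /=.
    by case: (side_of y u); case: (side_of y v).
- case=> n [[h1 h2 sx] [h3 h4] h5 h6 h7].
  apply/ExP; exists (size x); first by rewrite evalE; lia.
  rewrite !istrue_And; apply/and3P; split.
  + apply/AllP => i hi; rewrite istrue_Bitat !evalE /upd /= nth_pair_bits ifT.
      by rewrite modnMr.
    by move: hi; rewrite evalE /upd /=; lia.
  + by rewrite istrue_Not istrue_Bitat !evalE /upd /= nth_pair_bits ltnn eqxx.
  apply/ExP; exists n; first by rewrite evalE /upd /=; lia.
  set env := upd _ 1 n; rewrite !istrue_And.
  apply/and4P; split; [apply/and3P; split| | |apply/and3P; split].
  + apply/AllP => i hi; rewrite eval_X; first exact: h1.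
    by move: hi; rewrite !evalE sx /env /upd /=; lia.
  + by rewrite istrue_Not eval_X // evalE /env /upd /=; lia.
  + by rewrite istrue_Eq !evalE; apply/eqP.
  + apply/AllP => u hu; apply/AllP => v hv.
    rewrite istrue_Or istrue_Not !(@eval_adj _ n) //.
    by rewrite -implybE; apply/implyP; apply: h3.
  + by apply/AllP => u hu; rewrite istrue_Not (@eval_adj _ n) //; apply: h4.
  + apply/AllP => k hk; have [u hu e] := h5 k hk.
    by apply/ExP; exists u; rewrite // istrue_Eq eval_color //; apply/eqP.
  + apply/AllP => u hu; apply/AllP => v hv; apply/AllP => z hz.
    rewrite !(istrue_Or, istrue_Not, istrue_Eq) !(@eval_adj _ n) //.
    rewrite !eval_color // !evalE /upd /=.
    case: eqP => //= uz; case auv: (adj_of _ _ u v) => //=; case avz: (adj_of _ _ v z) => //=.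
    by case: eqP => //= e; apply/eqP; exact: h6 auv avz e.
  + case: ifP => [hb|_]; last by rewrite istrue_Bool.
    apply/AllP => u hu; apply/AllP => v hv.
    rewrite istrue_Or !istrue_Not istrue_Eq (@eval_adj _ n) // !eval_side // !evalE /upd /=.
    case auv: (adj_of _ _ u v) => //=; have := h7 hb u v hu hv auv.
    by case: (side_of y u); case: (side_of y v).
Qed.

End Fixed.

(** One direction rebuilds the graph from the checked bits; the other writes the colour of each
    vertex in unary, followed by its side. *)
Lemma verifier_correct x :
  (exists2 y, size y <= poly_bound p 1 (size x) & verifier (pair_bits x y)) <->
  exists G : sgraph, [/\ x = encode_graph G, has_P3_convex_partition p G & bip -> bipartite G].
Proof.
split.
- case=> y _ /verifierP[n [[h1 h2 sx] [h3 h4] h5 h6 h7]].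
  pose a (u v : 'I_n) := adj_of x n u v.
  have a_sym : symmetric a by move=> u v; apply/idP/idP; apply: h3.
  have a_irr : irreflexive a by move=> u; apply/negbTE/h4.
  pose G := SGraph a_sym a_irr.
  exists G; split.
  + apply: (@eq_from_nth _ false); first by rewrite size_encode_graph.
    move=> i; rewrite sx => hi; case: (ltngtP i n) => hin.
    * by rewrite h1 // nth_encode_lt.
    * have n0 : 0 < n by case: (n) hi hin => //; lia.
      have dn : (i - (n + 1)) %/ n < n by rewrite ltn_divLR //; lia.
      have mn : (i - (n + 1)) %% n < n by rewrite ltn_mod.
      (* A position behind the header splits into row and column. *)
      have iE : i = n + 1 + ((i - (n + 1)) %/ n * n + (i - (n + 1)) %% n).
        by rewrite -divn_eq; lia.
      rewrite {1 2}iE.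
      exact/esym/(@nth_encode_adj G (Ordinal dn) (Ordinal mn)).
    * rewrite hin (negbTE h2); apply/esym/negbTE/negP => /nth_encode_order.
      exact.
  + rewrite P3_convex_partition_coloring //.
    (* A colour is a number of ones among [p - 1] bits, so every certificate yields a legal
       colour. *)
    have c_lt u : color_of y u < p.
      rewrite ltnS -[p'.+1]card_ord -sum1_card; apply: leq_sum => k _.
      by case: nth.
    exists (fun u => Ordinal (c_lt u)); split=> [k|u v z uz auv avz [e]].
      have [u hu e] := h5 k (ltn_ord k); exists (Ordinal hu); exact: val_inj.
    apply: val_inj; apply: h6 auv avz e => //.
    by move/val_inj => e'; rewrite e' eqxx in uz.
  + by move=> hb; exists (fun u : 'I_n => side_of y u) => u v; apply: h7.
- case=> G [-> /P3_convex_partition_coloring[//|c [surj conv]] hb].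
  pose n := order G.
  have [s sP] : exists s : vertex G -> bool, bip -> forall u v, adj u v -> s u != s v.
    case: bip hb => [hb|_]; last by exists (fun=> false).
    by have [s h] := hb isT; exists s.
  pose bit (u : vertex G) (k : nat) := if k < p'.+1 then k < c u else s u.
  pose y := [seq bit u k | u <- enum (vertex G), k <- iota 0 p].
  have y_nth (u : vertex G) k : k < p -> nth false y (u * p + k) = bit u k.
    move=> hk; have := @nth_allpairs _ _ _ bit (enum (vertex G)) (iota 0 p) false u 0 u k.
    by rewrite size_enum_ord size_iota nth_ord_enum nth_iota //; apply.
  have cy (u : vertex G) : color_of y u = c u.
    rewrite /color_of (eq_bigr (fun k : 'I_p'.+1 => nat_of_bool (k < c u))) => [|k _].
      by rewrite sum_ltn; apply/minn_idPr; rewrite -ltnS.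
    by rewrite y_nth ?/bit ?ltn_ord // ltnW // ltnS.
  have sy (u : vertex G) : side_of y u = s u.
    by rewrite /side_of y_nth // /bit ltnn.
  exists y.
    rewrite size_allpairs size_enum_ord size_iota size_encode_graph /poly_bound.
    by rewrite expn1; nia.
  have adjO (u v : 'I_n) : adj_of (encode_graph G) n u v = adj u v.
    exact: nth_encode_adj.
  apply/verifierP; exists n; split.
  + split; [exact: nth_encode_lt| |exact: size_encode_graph].
    by apply/negP => /nth_encode_order.
  + split=> [u v hu hv|u hu].
      by rewrite (adjO (Ordinal hu) (Ordinal hv)) (adjO (Ordinal hv) (Ordinal hu)) adj_sym.
    by rewrite (adjO (Ordinal hu) (Ordinal hu)) adj_irr.
  + move=> k hk; have [u uk] := surj (Ordinal hk).
    by exists u; rewrite ?cy ?uk //; exact: ltn_ord.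
  + move=> u v z hu hv hz uz.
    rewrite (adjO (Ordinal hu) (Ordinal hv)) (adjO (Ordinal hv) (Ordinal hz)) => auv avz.
    rewrite (cy (Ordinal hu)) (cy (Ordinal hv)) (cy (Ordinal hz)) => /val_inj e.
    congr val; apply: conv auv avz e.
    by apply/eqP => -[].
  + move=> hb' u v hu hv; rewrite (adjO (Ordinal hu) (Ordinal hv)) => auv.
    by rewrite (sy (Ordinal hu)) (sy (Ordinal hv)); apply: sP.
Qed.

End Verifier.

(** * Membership in NP, hardness and completeness *)

Lemma NP_P3_convex_partition p' :
  NP (yes_language (P3_convex_partition_problem p'.+2)).
Proof.
exists (verifier p' false), p'.+2, 1; split; first exact: poly_time_verifier.
move=> x; rewrite verifier_correct; split.
- by case=> G /= xE hG; exists G.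
- by case=> G [xE hG _]; exists G.
Qed.

Lemma NP_P3_convex_partition_bipartite p' :
  NP (yes_language (@restrict (P3_convex_partition_problem p'.+2) bipartite)).
Proof.
exists (verifier p' true), p'.+2, 1; split; first exact: poly_time_verifier.
move=> x; rewrite verifier_correct; split.
- by case=> -[G bG] /= xE hG; exists G.
- by case=> G [xE hG /(_ isT) bG]; exists (exist _ G bG).
Qed.

Lemma NP_hard_P3_convex_partition_bipartite p' :
  NP_hard (@restrict (P3_convex_partition_problem p'.+2) bipartite).
Proof.
move=> L [V [cs [ds [[M [ct [dt MV]]] LV]]]].
exists (fun w => encode_graph (system_graph (grid p' M cs ds ct dt) p'.+2 w)).
  exact: poly_time_tableau.
move=> x.
exists (exist _ (system_graph (grid p' M cs ds ct dt) p'.+2 x) (gadget_bipartite _ _ _)) => //.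
by rewrite LV; apply: iff_sym; exact: (tableau_partition p' cs ds x MV).
Qed.

Theorem theorem9 (p : nat) (hp : 2 <= p) :
  NP_complete (P3_convex_partition_problem p) /\
  NP_complete (@restrict (P3_convex_partition_problem p) bipartite).
Proof.
case: p hp => [|[|p']] // _.
have hard := @NP_hard_P3_convex_partition_bipartite p'.
split; split; [exact: NP_P3_convex_partition| |
  exact: NP_P3_convex_partition_bipartite|exact: hard].
(* The reduction to bipartite instances serves for all graphs: the proof of bipartiteness is
   forgotten. *)
move=> L /hard[f ft fP]; exists f => // x.
by have [[G bG] /= fx xG] := fP x; exists G.
Qed.
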